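(* Let $i\in\mathbb{N}_0$ and let $\alpha,\beta,\epsilon\in\mathbb{C}$. Then $$F^{0:2;2}_{1:0;0}\left[\begin{matrix}-: & \alpha,\ \epsilon\,; & \beta-\epsilon,\ 1-\alpha-\epsilon+i\,;\\ \beta: & -\,; & -\,;\end{matrix}\ \tfrac12,\ -1\right] =\frac{2^{\alpha-i+2\epsilon-2}\,\Gamma(1-\epsilon)\,\Gamma(\beta)}{\Gamma(1-\epsilon+i)\,\Gamma(\beta+\epsilon-i-1)}\sum_{r=0}^{i}(-1)^r\binom{i}{r}\frac{\Gamma\!\left(\frac{\beta+\epsilon-i+r-1}{2}\right)}{\Gamma\!\left(\frac{\beta-\epsilon-i+r+1}{2}\right)}$$ and $$F^{0:2;2}_{1:0;0}\left[\begin{matrix}-: & \alpha,\ \epsilon\,; & \beta-\epsilon,\ 1-\alpha-\epsilon-i\,;\\ \beta: & -\,; & -\,;\end{matrix}\ \tfrac12,\ -1\right] =\frac{2^{\alpha+i+2\epsilon-2}\,\Gamma(\beta)}{\Gamma(\beta+\epsilon+i-1)}\sum_{r=0}^{i}\binom{i}{r}\frac{\Gamma\!\left(\frac{\beta+\epsilon+i+r-1}{2}\right)}{\Gamma\!\left(\frac{\beta-\epsilon-i+r+1}{2}\right)}.$$ (The left-hand sides are the Appell series $F_3$ with numerator parameters $\alpha,\epsilon$ attached to the first variable, $\beta-\epsilon,\gamma$ attached to the second, and denominator $\beta$, where $\gamma=1-\alpha-\epsilon\pm i$.)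
   Context: For $\lambda\in\mathbb{C}$ and $n\in\mathbb{N}_0$, $(\lambda)_0=1$ and $(\lambda)_n=\lambda(\lambda+1)\cdots(\lambda+n-1)$; $\Gamma$ is Euler's Gamma function and $\binom{i}{r}$ the binomial coefficient. The (generalized) Kampé de Fériet function is defined by $$F^{H:A;B}_{G:C;D}\left[\begin{matrix}(h_H): & (a_A)\,; & (b_B)\,;\\ (g_G): & (c_C)\,; & (d_D)\,;\end{matrix}\ x,\ y\right]=\sum_{m=0}^\infty\sum_{n=0}^\infty\frac{\prod_{j=1}^H(h_j)_{m+n}\prod_{j=1}^A(a_j)_m\prod_{j=1}^B(b_j)_n}{\prod_{j=1}^G(g_j)_{m+n}\prod_{j=1}^C(c_j)_m\prod_{j=1}^D(d_j)_n}\frac{x^m}{m!}\frac{y^n}{n!},$$ where a dash ''$-$'' denotes an empty list of parameters (empty products equal $1$). In particular $F^{0:2;2}_{1:0;0}[-:\alpha,\epsilon;\beta-\epsilon,\gamma;\ \beta:-;-;\ x,y]=\sum_{m,n\ge0}\frac{(\alpha)_m(\epsilon)_m(\beta-\epsilon)_n(\gamma)_n}{(\beta)_{m+n}}\frac{x^my^n}{m!\,n!}$ (Appell's $F_3$). Parameters are tacitly assumed to be such that the double series converges, no denominator parameter is a non-positive integer, and all Gamma values appearing are finite. *)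

(* Defs.v *)
From Stdlib Require Import Reals ClassicalEpsilon Factorial.
From Coquelicot Require Import Coquelicot.
Open Scope C_scope.

Definition Cexp (z : C) : C :=
  (exp (Re z) * cos (Im z), exp (Re z) * sin (Im z))%R.

Definition Cpow_pos (a : R) (z : C) : C := Cexp (z * RtoC (ln a)).

Fixpoint poch (l : C) (n : nat) : C :=
  match n with
  | O => 1
  | S k => poch l k * (l + RtoC (INR k))
  end.

(* Euler's Gamma function on C via Gauss' product formula
   Gamma(z) = lim_{n->oo} n! n^z / (z (z+1) ... (z+n)),
   valid for every z which is not a non-positive integer. *)
Definition gauss_seq (z : C) (n : nat) : C :=
  RtoC (INR (fact n)) * Cpow_pos (INR n) z / poch z (S n).

Definition is_Gamma (z g : C) : Prop :=
  filterlim (gauss_seq z) eventually (locally g).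

Definition Gamma (z : C) : C :=
  epsilon (inhabits (RtoC 0)) (fun g => is_Gamma z g).

Definition nonpos_int (z : C) : Prop := exists k : nat, z = - RtoC (INR k).

Definition binom (n k : nat) : R := Stdlib.Reals.Binomial.C n k.

Definition csum (f : nat -> C) (N : nat) : C := sum_n f N.

Definition dpartial (a : nat -> nat -> C) (M N : nat) : C :=
  sum_n (fun m => sum_n (fun n => a m n) N) M.

Definition double_series_converges_to (a : nat -> nat -> C) (L : C) : Prop :=
  forall eps : R, (0 < eps)%R ->
    exists K : nat, forall M N : nat, (K <= M)%nat -> (K <= N)%nat ->
      (Cmod (dpartial a M N - L) < eps)%R.

(* general term of F^{0:2;2}_{1:0;0}[-: a1,a2; b1,b2; g: -; -; x, y]  (Appell F3) *)
Definition F3_term (a1 a2 b1 b2 g x y : C) (m n : nat) : C :=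
  poch a1 m * poch a2 m * poch b1 n * poch b2 n / poch g (m + n)
  * (pow_n x m / RtoC (INR (fact m))) * (pow_n y n / RtoC (INR (fact n))).

(* Main.v *)
(** The reciprocal Gamma function [rG] is obtained as the limit of the inverted Gauss products, and
    2F1(a, b; c; 1/2) is studied in the regularised form [hreg a b c] = 2F1(a, b; c; 1/2) / Gamma(c),
    which makes sense for every complex c.

    The Appell series reduces to a single one: summing over the first variable turns it into
    sum_n (-1)^n (gamma)_n/n! B_n, which converges only conditionally.  Euler's transformation with
    binomial weights (a regular summation method) replaces it by
    2^(-gamma) sum_k 2^(-k) (gamma)_k/k! Delta^k B, where Delta^k B is given by Chu-Vandermonde.  The
    new double series converges absolutely, and a diagonal summation collapses it to
    2^(-gamma) 2F1(eps, alpha + gamma; beta; 1/2) with alpha + gamma = 1 - eps +- i.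

    For i = 0 this is Bailey's theorem: both sides satisfy the same recurrence c -> c + 2, and they
    agree asymptotically as c + 2N -> oo.  The case of general i follows by induction from two
    contiguous relations, Pascal's rule producing the binomial sums. *)

Require Import Defs.
From Stdlib Require Import Reals Lra Lia ClassicalEpsilon Factorial.
From Coquelicot Require Import Coquelicot.
Open Scope C_scope.

(** * Limits and geometrically dominated series in C *)

(** The point (1/2, -1) lies on the boundary of convergence in the second variable, so only the
    rectangular partial sums are assumed to tend to L and the terms may not be regrouped at will.
    The sum over m is geometrically dominated, which is why it is carried out before anything else.
    Euler's step is (1 + E)^(-gamma) = (2 - D)^(-gamma) with E the shift in n and D = 1 - E,
    expanded in powers of D/2. The parameter beta - eps is what makes the later collapse possible:
    the k-th difference of (beta - eps)_n / (beta + m)_n is (eps + m)_k / (beta + m)_k, which merges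
    with (eps)_m / (beta)_m into a factor depending on k + m alone. The recurrences in c walk across
    the poles of Gamma, so all intermediate identities are phrased with 1/Gamma; [Gamma] itself
    enters only at the end, through [Gamma_rG]. Pochhammer quotients grow polynomially, hence below
    a multiple of (6/5)^k. Two such bounds against 2^(-k) leave (18/25)^k, the ratio that recurs
    throughout. *)

Definition Clim (u : nat -> C) (l : C) : Prop :=
  is_lim_seq (fun n => Re (u n)) (Re l) /\ is_lim_seq (fun n => Im (u n)) (Im l).

Lemma RtoC_neq0 (x : R) : x <> 0%R -> RtoC x <> 0.
Proof. intros H E; apply H, RtoC_inj, E. Qed.

Lemma Re_le_Cmod (z : C) : (Rabs (Re z) <= Cmod z)%R.
Proof. exact (re_le_Cmod z). Qed.

Lemma Im_le_Cmod (z : C) : (Rabs (Im z) <= Cmod z)%R.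
Proof. exact (Rle_trans _ _ _ (Rmax_r _ _) (Rmax_Cmod z)). Qed.

Lemma Cmod_le_Re_Im (z : C) : (Cmod z <= Rabs (Re z) + Rabs (Im z))%R.
Proof.
  destruct z as [x y]; unfold Re, Im; simpl.
  replace (x, y) with (RtoC x + Ci * RtoC y)
    by (unfold Ci, Cplus, Cmult, RtoC; simpl; f_equal; ring).
  eapply Rle_trans; [apply Cmod_triangle|].
  rewrite Cmod_mult, Cmod_Ci, !Cmod_R; lra.
Qed.

Lemma Clim_eps (u : nat -> C) (l : C) :
  Clim u l <-> forall e : R, (0 < e)%R ->
    exists N, forall n, (N <= n)%nat -> (Cmod (u n - l) < e)%R.
Proof.
  split.
  - intros [HR HI] e He.
    apply is_lim_seq_spec in HR; apply is_lim_seq_spec in HI.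
    assert (He2 : (0 < e / 2)%R) by lra.
    destruct (HR (mkposreal _ He2)) as [N1 H1]; destruct (HI (mkposreal _ He2)) as [N2 H2].
    exists (N1 + N2)%nat; intros n Hn.
    specialize (H1 n ltac:(lia)); specialize (H2 n ltac:(lia)); simpl in H1, H2.
    eapply Rle_lt_trans; [apply Cmod_le_Re_Im|].
    change (Re (u n - l)) with (Re (u n) - Re l)%R.
    change (Im (u n - l)) with (Im (u n) - Im l)%R; lra.
  - intros H; split; apply is_lim_seq_spec; intros e; destruct (H e (cond_pos e)) as [N HN];
      exists N; intros n Hn; specialize (HN n Hn).
    + exact (Rle_lt_trans _ _ _ (Re_le_Cmod (u n - l)) HN).
    + exact (Rle_lt_trans _ _ _ (Im_le_Cmod (u n - l)) HN).
Qed.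

Lemma Clim_filterlim (u : nat -> C) (l : C) :
  Clim u l <-> filterlim u eventually (locally l).
Proof.
  rewrite Clim_eps; split.
  - intros H P [e He]; destruct (H e (cond_pos e)) as [N HN].
    exists N; intros n Hn; apply He.
    apply C_NormedModule_mixin_compat1; exact (HN n Hn).
  - intros H e He.
    (* Balls in C are squares here, which costs a factor sqrt 2 when passing to [Cmod]. *)
    assert (Hs : (0 < sqrt 2)%R) by (apply sqrt_lt_R0; lra).
    assert (He2 : (0 < e / sqrt 2)%R) by (apply Rdiv_lt_0_compat; lra).
    destruct (H (ball l (e / sqrt 2)) (locally_ball l (mkposreal _ He2))) as [N HN].
    exists N; intros n Hn.
    assert (B := C_NormedModule_mixin_compat2 l (u n) (mkposreal _ He2) (HN n Hn)).
    simpl in B; replace (sqrt 2 * (e / sqrt 2))%R with e in B by (field; lra); exact B.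
Qed.

Lemma Clim_ext_loc (u v : nat -> C) (l : C) (N : nat) :
  (forall n, (N <= n)%nat -> u n = v n) -> Clim u l -> Clim v l.
Proof.
  intros H [HR HI]; split; [eapply is_lim_seq_ext_loc, HR|eapply is_lim_seq_ext_loc, HI];
    exists N; intros n Hn; now rewrite (H n Hn).
Qed.

Lemma Clim_ext (u v : nat -> C) (l : C) : (forall n, u n = v n) -> Clim u l -> Clim v l.
Proof. intros H; apply Clim_ext_loc with (N := 0%nat); auto. Qed.

Lemma Clim_const (c : C) : Clim (fun _ => c) c.
Proof. split; apply is_lim_seq_const. Qed.

Lemma Clim_plus (u v : nat -> C) (a b : C) :
  Clim u a -> Clim v b -> Clim (fun n => u n + v n) (a + b).
Proof. intros [H1 H2] [H3 H4]; split; now apply is_lim_seq_plus'. Qed.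

Lemma Clim_mult (u v : nat -> C) (a b : C) :
  Clim u a -> Clim v b -> Clim (fun n => u n * v n) (a * b).
Proof.
  intros [H1 H2] [H3 H4]; split; simpl.
  - apply is_lim_seq_minus'; now apply is_lim_seq_mult'.
  - apply is_lim_seq_plus'; now apply is_lim_seq_mult'.
Qed.

Lemma Clim_scal (c : C) (u : nat -> C) (a : C) :
  Clim u a -> Clim (fun n => c * u n) (c * a).
Proof. apply Clim_mult, Clim_const. Qed.

Lemma Clim_opp (u : nat -> C) (a : C) : Clim u a -> Clim (fun n => - u n) (- a).
Proof.
  intros [H1 H2]; split.
  - exact (proj1 (is_lim_seq_opp _ _) H1).
  - exact (proj1 (is_lim_seq_opp _ _) H2).
Qed.

Lemma Clim_minus (u v : nat -> C) (a b : C) :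
  Clim u a -> Clim v b -> Clim (fun n => u n - v n) (a - b).
Proof. intros H1 H2; apply Clim_plus, Clim_opp; assumption. Qed.

Lemma Clim_inv (u : nat -> C) (a : C) : a <> 0 -> Clim u a -> Clim (fun n => / u n) (/ a).
Proof.
  intros Ha [HR HI].
  assert (Hn : (Re a ^ 2 + Im a ^ 2 <> 0)%R).
  { intros E; apply Ha; destruct a as [x y]; unfold Re, Im in E; simpl in E.
    unfold RtoC; f_equal; nra. }
  assert (HD : is_lim_seq (fun n => (Re (u n) ^ 2 + Im (u n) ^ 2)%R) (Re a ^ 2 + Im a ^ 2)%R).
  { simpl; apply is_lim_seq_plus'; repeat apply is_lim_seq_mult'; auto using is_lim_seq_const. }
  split.
  - exact (is_lim_seq_div' _ _ _ _ HR HD Hn).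
  - exact (is_lim_seq_div' _ _ _ _ (proj1 (is_lim_seq_opp _ _) HI) HD Hn).
Qed.

Lemma Clim_unique (u : nat -> C) (a b : C) : Clim u a -> Clim u b -> a = b.
Proof.
  intros [H1 H2] [H3 H4]; destruct a, b; f_equal.
  - apply is_lim_seq_unique in H1; apply is_lim_seq_unique in H3; rewrite H1 in H3.
    now injection H3.
  - apply is_lim_seq_unique in H2; apply is_lim_seq_unique in H4; rewrite H2 in H4.
    now injection H4.
Qed.

Lemma Clim_shift (u : nat -> C) (l : C) (k : nat) :
  Clim u l <-> Clim (fun n => u (n + k)%nat) l.
Proof.
  split; intros [HR HI]; split.
  - now apply (is_lim_seq_incr_n (fun n => Re (u n))).
  - now apply (is_lim_seq_incr_n (fun n => Im (u n))).
  - now apply (is_lim_seq_incr_n (fun n => Re (u n)) k).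
  - now apply (is_lim_seq_incr_n (fun n => Im (u n)) k).
Qed.

Lemma Clim_subseq (u : nat -> C) (l : C) (phi : nat -> nat) :
  (forall n, (n <= phi n)%nat) -> Clim u l -> Clim (fun n => u (phi n)) l.
Proof.
  intros Hp; rewrite !Clim_eps; intros H e He; destruct (H e He) as [N HN].
  exists N; intros n Hn; apply HN; specialize (Hp n); lia.
Qed.

Lemma Clim_Cmod_le (u : nat -> C) (l x : C) (B : R) (N : nat) :
  Clim u l -> (forall n, (N <= n)%nat -> (Cmod (u n - x) <= B)%R) -> (Cmod (l - x) <= B)%R.
Proof.
  rewrite Clim_eps; intros H HB; apply Rnot_lt_le; intros Hlt.
  destruct (H (Cmod (l - x) - B)%R ltac:(lra)) as [K HK].
  specialize (HK (N + K)%nat ltac:(lia)); specialize (HB (N + K)%nat ltac:(lia)).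
  assert (T := Cmod_triangle (u (N + K)%nat - x) (- (u (N + K)%nat - l))).
  rewrite Cmod_opp in T.
  replace (u (N + K)%nat - x + - (u (N + K)%nat - l)) with (l - x) in T by ring; lra.
Qed.

Lemma Clim_0_le (u : nat -> C) (b : nat -> R) :
  (forall n, (Cmod (u n) <= b n)%R) -> is_lim_seq b 0 -> Clim u 0.
Proof.
  intros Hb Hl; apply Clim_eps; intros e He.
  apply is_lim_seq_spec in Hl; destruct (Hl (mkposreal e He)) as [N HN].
  exists N; intros n Hn; specialize (HN n Hn); simpl in HN.
  replace (u n - 0) with (u n) by ring.
  rewrite Rminus_0_r in HN; apply Rabs_def2 in HN; specialize (Hb n); lra.
Qed.

(* [cs f n] sums the first [n] terms, so [cs f (S N)] is [sum_n f N]. *)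
Fixpoint cs (f : nat -> C) (n : nat) : C :=
  match n with O => 0 | S k => cs f k + f k end.

Lemma sum_n_cs (f : nat -> C) (N : nat) : sum_n f N = cs f (S N).
Proof.
  induction N as [|N IH]; [rewrite sum_O; simpl; ring|].
  rewrite sum_Sn, IH; reflexivity.
Qed.

Lemma cs_ext (f g : nat -> C) (n : nat) :
  (forall k, (k < n)%nat -> f k = g k) -> cs f n = cs g n.
Proof.
  induction n as [|n IH]; intros H; simpl; [reflexivity|].
  rewrite IH, H by auto with arith; reflexivity.
Qed.

Lemma cs_plus (f g : nat -> C) (n : nat) : cs (fun k => f k + g k) n = cs f n + cs g n.
Proof. induction n as [|n IH]; simpl; [ring|rewrite IH; ring]. Qed.

Lemma cs_scal (c : C) (f : nat -> C) (n : nat) : cs (fun k => c * f k) n = c * cs f n.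
Proof. induction n as [|n IH]; simpl; [ring|rewrite IH; ring]. Qed.

Lemma cs_minus (f g : nat -> C) (n : nat) : cs (fun k => f k - g k) n = cs f n - cs g n.
Proof. induction n as [|n IH]; simpl; [ring|rewrite IH; ring]. Qed.

Lemma cs_first (f : nat -> C) (n : nat) : cs f (S n) = f O + cs (fun k => f (S k)) n.
Proof.
  induction n as [|n IH]; [simpl; ring|].
  change (cs f (S (S n))) with (cs f (S n) + f (S n)); rewrite IH; simpl; ring.
Qed.

Lemma cs_telescope (G : nat -> C) (n : nat) : cs (fun k => G (S k) - G k) n = G n - G O.
Proof. induction n as [|n IH]; simpl; [ring|rewrite IH; ring]. Qed.

Lemma cs_swap (f : nat -> nat -> C) (M N : nat) :
  cs (fun m => cs (fun n => f m n) N) M = cs (fun n => cs (fun m => f m n) M) N.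
Proof.
  induction M as [|M IH]; simpl.
  - induction N as [|N IHN]; simpl; [reflexivity|rewrite <- IHN; ring].
  - rewrite IH, <- cs_plus; apply cs_ext; intros; reflexivity.
Qed.

(** Both sides sum f over the triangle n + k < J. Raising J appends one entry to each row and opens
    a new row of length one. *)
Lemma cs_diag (f : nat -> nat -> C) (J : nat) :
  cs (fun j => cs (fun n => f n (j - n)%nat) (S j)) J
  = cs (fun n => cs (fun k => f n k) (J - n)) J.
Proof.
  induction J as [|J IH]; [reflexivity|].
  change (cs (fun j => cs (fun n => f n (j - n)%nat) (S j)) (S J))
    with (cs (fun j => cs (fun n => f n (j - n)%nat) (S j)) J
          + cs (fun n => f n (J - n)%nat) (S J)).
  rewrite IH.
  change (cs (fun n => f n (J - n)%nat) (S J))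
    with (cs (fun n => f n (J - n)%nat) J + f J (J - J)%nat).
  change (cs (fun n => cs (fun k => f n k) (S J - n)) (S J))
    with (cs (fun n => cs (fun k => f n k) (S J - n)) J + cs (fun k => f J k) (S J - J)).
  replace (S J - J)%nat with 1%nat by lia; rewrite Nat.sub_diag.
  rewrite (cs_ext (fun n => cs (fun k => f n k) (S J - n))
             (fun n => cs (fun k => f n k) (J - n) + f n (J - n)%nat) J).
  - rewrite cs_plus; simpl; ring.
  - intros k Hk; replace (S J - k)%nat with (S (J - k)) by lia; reflexivity.
Qed.

Lemma Clim_cs (f : nat -> nat -> C) (l : nat -> C) (n : nat) :
  (forall k, (k < n)%nat -> Clim (fun N => f N k) (l k)) ->
  Clim (fun N => cs (f N) n) (cs l n).
Proof.
  induction n as [|n IH]; intros H; simpl; [apply Clim_const|].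
  apply Clim_plus; auto with arith.
Qed.

(** * Series with geometrically bounded terms *)

Definition geo_bound (A r : R) (u : nat -> C) : Prop :=
  forall k, (Cmod (u k) <= A * r ^ k)%R.

Definition geo (u : nat -> C) : Prop :=
  exists A r, (0 <= r < 1)%R /\ geo_bound A r u.

Definition CSer (u : nat -> C) : C :=
  (Series (fun k => Re (u k)), Series (fun k => Im (u k))).

Lemma cs_Re_Im (u : nat -> C) (n : nat) :
  cs u (S n) = (sum_n (fun k => Re (u k)) n, sum_n (fun k => Im (u k)) n).
Proof.
  induction n as [|n IH].
  - simpl; rewrite !sum_O; destruct (u O); unfold Cplus, RtoC, Re, Im; simpl; f_equal; ring.
  - change (cs u (S (S n))) with (cs u (S n) + u (S n)); rewrite IH, !sum_Sn; reflexivity.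
Qed.

Lemma ex_series_geo_comp (A r : R) (v : nat -> R) :
  (0 <= r < 1)%R -> (forall k, (Rabs (v k) <= A * r ^ k)%R) -> ex_series v.
Proof.
  intros Hr Hv; apply (@ex_series_le _ R_CompleteNormedModule v (fun k => A * r ^ k)%R).
  - exact Hv.
  - apply (ex_series_scal_l A (fun k => (r ^ k)%R)), ex_series_geom.
    rewrite Rabs_pos_eq; lra.
Qed.

Lemma CSer_lim (u : nat -> C) : geo u -> Clim (cs u) (CSer u).
Proof.
  intros (A & r & Hr & Hu); apply (Clim_shift _ _ 1).
  apply (Clim_ext (fun n => (sum_n (fun k => Re (u k)) n, sum_n (fun k => Im (u k)) n))).
  { intros n; rewrite Nat.add_1_r, cs_Re_Im; reflexivity. }
  split; simpl.
  - apply (Series_correct (fun k => Re (u k))), (ex_series_geo_comp A r); auto.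
    intros k; eapply Rle_trans; [apply Re_le_Cmod|apply Hu].
  - apply (Series_correct (fun k => Im (u k))), (ex_series_geo_comp A r); auto.
    intros k; eapply Rle_trans; [apply Im_le_Cmod|apply Hu].
Qed.

Lemma CSer_unique (u : nat -> C) (l : C) : geo u -> Clim (cs u) l -> CSer u = l.
Proof. intros Hu; apply Clim_unique, CSer_lim, Hu. Qed.

Lemma cs_tail (A r : R) (u : nat -> C) (K n : nat) :
  (0 <= r < 1)%R -> geo_bound A r u ->
  (Cmod (cs u (n + K) - cs u K) <= A * r ^ K / (1 - r))%R.
Proof.
  intros Hr Hu.
  assert (HA : (0 <= A)%R).
  { specialize (Hu O); simpl in Hu; assert (H := Cmod_ge_0 (u O)); lra. }
  (* The factor 1 - r^n turns the bound into an exact finite geometric sum, so that the induction on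
     n closes. *)
  enough (Cmod (cs u (n + K) - cs u K) <= A * r ^ K * (1 - r ^ n) / (1 - r))%R.
  { eapply Rle_trans; [eassumption|]; unfold Rdiv.
    apply Rmult_le_compat_r; [apply Rlt_le, Rinv_0_lt_compat; lra|].
    assert (0 <= A * r ^ K)%R by (apply Rmult_le_pos; [lra|apply pow_le; lra]).
    assert (0 <= r ^ n)%R by (apply pow_le; lra); nra. }
  induction n as [|n IH].
  - simpl; replace (cs u K - cs u K) with (RtoC 0) by ring; rewrite Cmod_0.
    right; field; lra.
  - simpl plus; simpl cs.
    replace (cs u (n + K) + u (n + K)%nat - cs u K)
      with (cs u (n + K) - cs u K + u (n + K)%nat) by ring.
    eapply Rle_trans; [apply Cmod_triangle|].
    specialize (Hu (n + K)%nat); rewrite pow_add in Hu.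
    replace (A * r ^ K * (1 - r ^ S n) / (1 - r))%R
      with (A * r ^ K * (1 - r ^ n) / (1 - r) + A * (r ^ n * r ^ K))%R
      by (simpl; field; lra).
    lra.
Qed.

Lemma CSer_tail (A r : R) (u : nat -> C) (K : nat) :
  (0 <= r < 1)%R -> geo_bound A r u ->
  (Cmod (CSer u - cs u K) <= A * r ^ K / (1 - r))%R.
Proof.
  intros Hr Hu; apply (Clim_Cmod_le (cs u) _ _ _ K).
  - apply CSer_lim; exists A, r; auto.
  - intros n Hn; replace n with (n - K + K)%nat by lia; now apply cs_tail.
Qed.

Lemma CSer_Cmod (A r : R) (u : nat -> C) :
  (0 <= r < 1)%R -> geo_bound A r u -> (Cmod (CSer u) <= A / (1 - r))%R.
Proof.
  intros Hr Hu; assert (H := CSer_tail A r u O Hr Hu); simpl in H.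
  replace (CSer u - 0) with (CSer u) in H by ring; rewrite Rmult_1_r in H; exact H.
Qed.

Lemma geo_tail_lim (A r : R) : (0 <= r < 1)%R -> is_lim_seq (fun K => A * r ^ K / (1 - r))%R 0.
Proof.
  intros Hr; apply (is_lim_seq_ext (fun K => (A / (1 - r)) * r ^ K)%R).
  { intros K; field; lra. }
  replace (Finite 0) with (Rbar_mult (A / (1 - r))%R 0) by (simpl; f_equal; ring).
  apply is_lim_seq_scal_l, is_lim_seq_geom; rewrite Rabs_pos_eq; lra.
Qed.

(** Tannery's theorem: the tails beyond K are at most A r^K / (1 - r) uniformly in N, and the first
    K terms converge one by one. The majorant passes to y in the limit. *)
Lemma CSer_dominated (A r : R) (x : nat -> nat -> C) (y : nat -> C) (N0 : nat) :
  (0 <= r < 1)%R -> (forall N, (N0 <= N)%nat -> geo_bound A r (x N)) ->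
  (forall k, Clim (fun N => x N k) (y k)) ->
  Clim (fun N => CSer (x N)) (CSer y).
Proof.
  intros Hr Hx Hy.
  assert (By : geo_bound A r y).
  { intros k; replace (y k) with (y k - 0) by ring.
    apply (Clim_Cmod_le (fun N => x N k) _ _ _ N0 (Hy k)).
    intros n Hn; replace (x n k - 0) with (x n k) by ring; now apply Hx. }
  apply Clim_eps; intros e He.
  assert (T := geo_tail_lim A r Hr); apply is_lim_seq_spec in T.
  assert (He3 : (0 < e / 3)%R) by lra.
  destruct (T (mkposreal _ He3)) as [K HK]; specialize (HK K (Nat.le_refl K)); simpl in HK.
  rewrite Rminus_0_r in HK; apply Rabs_def2 in HK.
  assert (F : Clim (fun N => cs (x N) K) (cs y K)) by (apply Clim_cs; auto).
  rewrite Clim_eps in F; destruct (F _ He3) as [N HN].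
  exists (N0 + N)%nat; intros n Hn; specialize (HN n ltac:(lia)).
  assert (T1 := CSer_tail A r (x n) K Hr (Hx n ltac:(lia))).
  assert (T2 := CSer_tail A r y K Hr By).
  replace (CSer (x n) - CSer y)
    with ((CSer (x n) - cs (x n) K) + ((cs (x n) K - cs y K) + - (CSer y - cs y K))) by ring.
  eapply Rle_lt_trans; [apply Cmod_triangle|].
  eapply Rle_lt_trans; [apply Rplus_le_compat_l, Cmod_triangle|].
  rewrite Cmod_opp; lra.
Qed.

Lemma geo_ext (u v : nat -> C) : (forall k, u k = v k) -> geo u -> geo v.
Proof.
  intros E (A & r & Hr & Hu); exists A, r; split; [exact Hr|].
  intros k; rewrite <- E; apply Hu.
Qed.

Lemma geo_scal (c : C) (u : nat -> C) : geo u -> geo (fun k => c * u k).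
Proof.
  intros (A & r & Hr & Hu); exists (Cmod c * A)%R, r; split; [exact Hr|].
  intros k; rewrite Cmod_mult, Rmult_assoc.
  apply Rmult_le_compat_l; [apply Cmod_ge_0|apply Hu].
Qed.

Lemma geo_bound_weaken (A r r' : R) (u : nat -> C) :
  (0 <= r <= r')%R -> geo_bound A r u -> geo_bound A r' u.
Proof.
  intros Hr Hu k; eapply Rle_trans; [apply Hu|].
  apply Rmult_le_compat_l; [|apply pow_incr; lra].
  specialize (Hu O); simpl in Hu; assert (H := Cmod_ge_0 (u O)); lra.
Qed.

Lemma geo_plus (u v : nat -> C) : geo u -> geo v -> geo (fun k => u k + v k).
Proof.
  intros (A & r & Hr & Hu) (B & s & Hs & Hv); exists (A + B)%R, (Rmax r s); split.
  { split; [apply Rle_trans with r; [lra|apply Rmax_l]|apply Rmax_lub_lt; lra]. }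
  intros k; eapply Rle_trans; [apply Cmod_triangle|].
  assert (H1 := Rmax_l r s); assert (H2 := Rmax_r r s).
  assert (H3 := geo_bound_weaken A r (Rmax r s) u ltac:(lra) Hu k).
  assert (H4 := geo_bound_weaken B s (Rmax r s) v ltac:(lra) Hv k); lra.
Qed.

Lemma geo_lim_0 (u : nat -> C) : geo u -> Clim u 0.
Proof.
  intros Hu; assert (H := CSer_lim u Hu).
  replace (RtoC 0) with (CSer u - CSer u) by ring.
  apply (Clim_ext (fun n => cs u (n + 1) - cs u n)).
  - intros n; rewrite Nat.add_1_r; simpl; ring.
  - apply Clim_minus; [now apply (Clim_shift (cs u) _ 1)|exact H].
Qed.

Lemma CSer_ext (u v : nat -> C) : (forall k, u k = v k) -> CSer u = CSer v.
Proof.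
  intros E; unfold CSer; f_equal; apply Series_ext; intros k; now rewrite E.
Qed.

Lemma CSer_plus (u v : nat -> C) :
  geo u -> geo v -> CSer (fun k => u k + v k) = CSer u + CSer v.
Proof.
  intros Hu Hv; apply CSer_unique; [now apply geo_plus|].
  apply (Clim_ext (fun n => cs u n + cs v n)); [intros n; now rewrite cs_plus|].
  apply Clim_plus; now apply CSer_lim.
Qed.

Lemma CSer_scal (c : C) (u : nat -> C) : geo u -> CSer (fun k => c * u k) = c * CSer u.
Proof.
  intros Hu; apply CSer_unique; [now apply geo_scal|].
  apply (Clim_ext (fun n => c * cs u n)); [intros n; now rewrite cs_scal|].
  apply Clim_scal; now apply CSer_lim.
Qed.

Lemma CSer_cs (f : nat -> nat -> C) (n : nat) :
  (forall k, (k < n)%nat -> geo (f k)) ->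
  geo (fun m => cs (fun k => f k m) n) /\
  CSer (fun m => cs (fun k => f k m) n) = cs (fun k => CSer (f k)) n.
Proof.
  induction n as [|n IH]; intros H; simpl.
  - assert (G : geo (fun _ => 0)).
    { exists 0%R, 0%R; split; [lra|]; intros k; rewrite Cmod_0; lra. }
    split; [exact G|]; apply CSer_unique; [exact G|].
    apply (Clim_ext (fun _ => 0)); [|apply Clim_const].
    intros m; induction m as [|m IHm]; simpl; [reflexivity|rewrite <- IHm; ring].
  - destruct IH as [G E]; [auto with arith|].
    split; [apply geo_plus; auto with arith|].
    rewrite CSer_plus, E by auto with arith; reflexivity.
Qed.

(** G is a telescoping certificate. It serves the relations between hypergeometric series that hold
    only after summation, not term by term. *)
Lemma CSer_telescope (u v G : nat -> C) :
  geo u -> geo v -> G O = 0 -> Clim G 0 ->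
  (forall k, u k - v k = G (S k) - G k) -> CSer u = CSer v.
Proof.
  intros Hu Hv G0 HG E.
  assert (L : Clim (fun n => cs u n - cs v n) (CSer u - CSer v))
    by (apply Clim_minus; now apply CSer_lim).
  assert (CSer u - CSer v = 0).
  { apply (Clim_unique (fun n => cs u n - cs v n)); [exact L|].
    apply (Clim_ext G); [|exact HG].
    intros n; rewrite <- cs_minus.
    rewrite (cs_ext _ (fun k => G (S k) - G k)) by auto.
    rewrite cs_telescope, G0; ring. }
  replace (CSer u) with (CSer u - CSer v + CSer v) by ring; rewrite H; ring.
Qed.

(** The first J diagonals fill a triangle whose rows are truncated rows of x. The truncated row sums
    are bounded by a geometric sequence in n, uniformly in J, so Tannery's theorem applies. *)
Lemma CSer_diag (A r : R) (x : nat -> nat -> C) :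
  (0 <= r < 1)%R -> (forall n k, (Cmod (x n k) <= A * r ^ (n + k))%R) ->
  Clim (cs (fun j => cs (fun n => x n (j - n)%nat) (S j))) (CSer (fun n => CSer (x n))).
Proof.
  intros Hr Hx.
  assert (HA : (0 <= A)%R).
  { specialize (Hx O O); simpl in Hx; assert (H := Cmod_ge_0 (x O O)); lra. }
  assert (Hrow : forall n, geo_bound (A * r ^ n) r (x n)).
  { intros n k; rewrite Rmult_assoc, <- pow_add; apply Hx. }
  assert (Hpart : forall n K, (Cmod (cs (x n) K) <= A / (1 - r) * r ^ n)%R).
  { intros n K; assert (H := cs_tail _ r (x n) O K Hr (Hrow n)); simpl in H.
    rewrite Nat.add_0_r in H; replace (cs (x n) K - 0) with (cs (x n) K) in H by ring.
    eapply Rle_trans; [exact H|]; right; field; lra. }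
  (* Row n cut down to the triangle n + k < J, and zero when the row misses it. *)
  set (y := fun J n => if Nat.ltb n J then cs (x n) (J - n) else RtoC 0).
  assert (Hy : forall J, geo_bound (A / (1 - r)) r (y J)).
  { intros J n; unfold y; destruct (Nat.ltb n J); [apply Hpart|].
    rewrite Cmod_0; apply Rmult_le_pos; [|apply pow_le; lra].
    apply Rmult_le_pos; [lra|]; apply Rlt_le, Rinv_0_lt_compat; lra. }
  assert (Hlim : Clim (fun J => CSer (y J)) (CSer (fun n => CSer (x n)))).
  { apply (CSer_dominated (A / (1 - r)) r _ _ 0 Hr); [auto|].
    intros n; apply (Clim_shift _ _ (S n)).
    apply (Clim_ext (fun J => cs (x n) (J + 1))).
    - intros J; unfold y; replace (Nat.ltb n (J + S n)) with true
        by (symmetry; apply Nat.ltb_lt; lia).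
      f_equal; lia.
    - apply -> (Clim_shift (cs (x n))); apply CSer_lim; exists (A * r ^ n)%R, r; auto. }
  eapply Clim_ext, Hlim; intros J.
  apply CSer_unique; [exists (A / (1 - r))%R, r; auto|].
  (* [y J] vanishes from index J on, so its series is a finite sum. *)
  apply (Clim_shift _ _ J); apply (Clim_ext (fun _ => cs (y J) J)).
  - intros n; induction n as [|n IH]; [reflexivity|].
    simpl; rewrite <- IH; unfold y at 3.
    replace (Nat.ltb (n + J) J) with false by (symmetry; apply Nat.ltb_ge; lia); ring.
  - rewrite cs_diag, (cs_ext (y J) (fun n => cs (fun k => x n k) (J - n)));
      [apply Clim_const|].
    intros n Hn; unfold y; apply Nat.ltb_lt in Hn; rewrite Hn; reflexivity.
Qed.

(** * Pochhammer symbols *)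

Definition nC (n : nat) : C := RtoC (INR n).

Definition factC (n : nat) : C := RtoC (INR (fact n)).

Lemma nC_S (n : nat) : nC (S n) = nC n + 1.
Proof. unfold nC; rewrite S_INR, RtoC_plus; reflexivity. Qed.

Lemma nC_0 : nC 0 = 0.
Proof. reflexivity. Qed.

Lemma nC_add (m n : nat) : nC (m + n) = nC m + nC n.
Proof. unfold nC; rewrite plus_INR, RtoC_plus; reflexivity. Qed.

Lemma nC_sub (m n : nat) : (n <= m)%nat -> nC (m - n) = nC m - nC n.
Proof. intros H; unfold nC; rewrite minus_INR, RtoC_minus by exact H; reflexivity. Qed.

Lemma nC_S_neq0 (n : nat) : nC n + 1 <> 0.
Proof. rewrite <- nC_S; apply RtoC_neq0, not_0_INR; lia. Qed.

Lemma Cmod_nC (n : nat) : Cmod (nC n) = INR n.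
Proof. unfold nC; rewrite Cmod_R, Rabs_pos_eq; [reflexivity|apply pos_INR]. Qed.

Lemma factC_S (n : nat) : factC (S n) = (nC n + 1) * factC n.
Proof.
  unfold factC; rewrite fact_simpl, mult_INR, RtoC_mult, <- nC_S; reflexivity.
Qed.

Lemma factC_0 : factC 0 = 1.
Proof. reflexivity. Qed.

Lemma factC_neq0 (n : nat) : factC n <> 0.
Proof. apply RtoC_neq0, INR_fact_neq_0. Qed.

Lemma nonpos_int_shift (z : C) (n : nat) : ~ nonpos_int z -> z + nC n <> 0.
Proof.
  intros H E; apply H; exists n; change (RtoC (INR n)) with (nC n).
  replace z with (z + nC n - nC n) by ring; rewrite E; ring.
Qed.

Lemma not_nonpos_int_add (z : C) (n : nat) : ~ nonpos_int z -> ~ nonpos_int (z + nC n).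
Proof.
  intros H [k E]; apply H; exists (k + n)%nat; rewrite plus_INR, RtoC_plus.
  change (RtoC (INR n)) with (nC n).
  replace z with (z + nC n - nC n) by ring; rewrite E; ring.
Qed.

Lemma Re_pos_not_nonpos_int (z : C) : (0 < Re z)%R -> ~ nonpos_int z.
Proof.
  intros H [k E]; rewrite E in H; simpl in H; assert (P := pos_INR k); lra.
Qed.

Lemma poch_S (z : C) (n : nat) : poch z (S n) = poch z n * (z + nC n).
Proof. reflexivity. Qed.

Lemma poch_first (z : C) (n : nat) : poch z (S n) = z * poch (z + 1) n.
Proof.
  induction n as [|n IH]; [simpl; ring|].
  rewrite poch_S, IH, poch_S, nC_S; ring.
Qed.

Lemma poch_add (z : C) (m n : nat) : poch z (m + n) = poch z m * poch (z + nC m) n.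
Proof.
  induction n as [|n IH]; [rewrite Nat.add_0_r; simpl; ring|].
  rewrite Nat.add_succ_r, !poch_S, IH, nC_add; ring.
Qed.

Lemma poch_neq0 (z : C) (n : nat) : ~ nonpos_int z -> poch z n <> 0.
Proof.
  intros H; induction n as [|n IH]; [simpl; apply RtoC_neq0; lra|].
  rewrite poch_S; apply Cmult_neq_0; [exact IH|now apply nonpos_int_shift].
Qed.

(** * Growth of Pochhammer quotients *)

Lemma geo_growth (u : nat -> C) (rho : R) (M : nat) :
  (0 < rho)%R -> (forall m, (M <= m)%nat -> (Cmod (u (S m)) <= rho * Cmod (u m))%R) ->
  exists A, (0 <= A)%R /\ geo_bound A rho u.
Proof.
  intros Hr; revert u; induction M as [|M IH]; intros u H.
  - exists (Cmod (u O)); split; [apply Cmod_ge_0|].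
    intros k; induction k as [|k IHk]; [simpl; lra|].
    eapply Rle_trans; [apply H; lia|]; simpl.
    apply Rmult_le_compat_l with (r := rho) in IHk; lra.
  - destruct (IH (fun k => u (S k))) as (A & HA & B).
    { intros m Hm; apply H; lia. }
    (* A rho^k for the shifted sequence is (A / rho) rho^(k+1); the first term is covered by its own
       modulus. *)
    exists (Cmod (u O) + A / rho)%R.
    assert (H0 := Cmod_ge_0 (u O)).
    assert (HAr : (0 <= A / rho)%R) by (apply Rmult_le_pos; [lra|apply Rlt_le, Rinv_0_lt_compat; lra]).
    split; [lra|].
    intros [|k]; [simpl; lra|].
    eapply Rle_trans; [apply B|]; simpl.
    assert (P : (0 <= rho ^ k)%R) by (apply pow_le; lra).
    replace (A * rho ^ k)%R with (A / rho * (rho * rho ^ k))%R by (field; lra).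
    apply Rmult_le_compat_r; [apply Rmult_le_pos; lra|lra].
Qed.

Lemma shift_ratio (a c : C) (rho : R) :
  (1 < rho)%R -> exists M, forall m, (M <= m)%nat ->
    c + nC m <> 0 /\ (Cmod (a + nC m) <= rho * Cmod (c + nC m))%R.
Proof.
  intros Hr.
  (* The first entry keeps c + m away from zero; the second solves |a| + m <= rho (m - |c|) for
     m. *)
  destruct (nfloor_ex (Rmax (Cmod c) ((Cmod a + rho * Cmod c) / (rho - 1)))) as [n Hn].
  { eapply Rle_trans; [apply (Cmod_ge_0 c)|apply Rmax_l]. }
  exists (S n); intros m Hm.
  assert (Hm' : (INR n + 1 <= INR m)%R) by (rewrite <- S_INR; apply le_INR; lia).
  assert (H1 := Rmax_l (Cmod c) ((Cmod a + rho * Cmod c) / (rho - 1))).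
  assert (H2 := Rmax_r (Cmod c) ((Cmod a + rho * Cmod c) / (rho - 1))).
  assert (L : (INR m - Cmod c <= Cmod (c + nC m))%R).
  { assert (T := Cmod_triangle (c + nC m) (- c)).
    replace (c + nC m + - c) with (nC m) in T by ring.
    rewrite Cmod_nC, Cmod_opp in T; lra. }
  assert (U : (Cmod (a + nC m) <= Cmod a + INR m)%R).
  { rewrite <- (Cmod_nC m); apply Cmod_triangle. }
  split.
  - intros E; rewrite E, Cmod_0 in L; lra.
  - assert (H3 : ((Cmod a + rho * Cmod c) / (rho - 1) <= INR m)%R) by lra.
    apply Rmult_le_compat_r with (r := (rho - 1)%R) in H3; [|lra].
    unfold Rdiv in H3; rewrite Rmult_assoc, Rinv_l in H3 by lra.
    apply Rmult_le_compat_l with (r := rho) in L; lra.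
Qed.

(** The factors (a + k) / (c + k) tend to 1, so the quotient grows more slowly than any rho^k with
    rho > 1. *)
Lemma poch_ratio_growth (a c : C) (rho : R) :
  ~ nonpos_int c -> (1 < rho)%R ->
  exists A, (0 <= A)%R /\ geo_bound A rho (fun k => poch a k / poch c k).
Proof.
  intros Hc Hr; destruct (shift_ratio a c rho Hr) as [M HM].
  apply (geo_growth _ _ M); [lra|].
  intros m Hm; destruct (HM m Hm) as [N L].
  rewrite !poch_S.
  replace (poch a m * (a + nC m) / (poch c m * (c + nC m)))
    with ((a + nC m) / (c + nC m) * (poch a m / poch c m))
    by (field; auto using poch_neq0).
  rewrite Cmod_mult, Cmod_div by exact N.
  apply Rmult_le_compat_r; [apply Cmod_ge_0|].
  apply Cmod_gt_0 in N; apply Rmult_le_reg_r with (Cmod (c + nC m)); [exact N|].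
  unfold Rdiv; rewrite Rmult_assoc, Rinv_l by lra; lra.
Qed.

Lemma poch_1 (n : nat) : poch 1 n = factC n.
Proof. induction n as [|n IH]; [reflexivity|]. rewrite poch_S, IH, factC_S; ring. Qed.

Lemma not_nonpos_int_1 : ~ nonpos_int 1.
Proof. apply Re_pos_not_nonpos_int; simpl; lra. Qed.

Lemma poch_fact_growth (a : C) (rho : R) :
  (1 < rho)%R -> exists A, (0 <= A)%R /\ geo_bound A rho (fun k => poch a k / factC k).
Proof.
  intros Hr; destruct (poch_ratio_growth a 1 rho not_nonpos_int_1 Hr) as (A & HA & B).
  exists A; split; [exact HA|]; intros k; specialize (B k); cbv beta in B; rewrite poch_1 in B; exact B.
Qed.

(** * Binomial sums and Vandermonde's identities *)

Lemma binom_0 (n : nat) : binom n 0 = 1%R.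
Proof. unfold binom, Binomial.C; rewrite Nat.sub_0_r; simpl; field; apply INR_fact_neq_0. Qed.

Lemma binom_diag (n : nat) : binom n n = 1%R.
Proof. unfold binom, Binomial.C; rewrite Nat.sub_diag; simpl; field; apply INR_fact_neq_0. Qed.

(** Pascal's rule in summed form. The inductions for the Chu-Vandermonde sum and for the shifted
    forms of Bailey's theorem run on it. *)
Lemma cs_binom_S (f : nat -> C) (i : nat) :
  cs (fun r => RtoC (binom (S i) r) * f r) (S (S i))
  = cs (fun r => RtoC (binom i r) * (f r + f (S r))) (S i).
Proof.
  rewrite cs_first, binom_0.
  rewrite (cs_ext (fun r => RtoC (binom i r) * (f r + f (S r)))
             (fun r => RtoC (binom i r) * f r + RtoC (binom i r) * f (S r))) by (intros; ring).
  rewrite cs_plus, (cs_first (fun r => RtoC (binom i r) * f r)), binom_0.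
  change (cs (fun r => RtoC (binom i r) * f (S r)) (S i))
    with (cs (fun r => RtoC (binom i r) * f (S r)) i + RtoC (binom i i) * f (S i)).
  change (cs (fun r => RtoC (binom (S i) (S r)) * f (S r)) (S i))
    with (cs (fun r => RtoC (binom (S i) (S r)) * f (S r)) i
          + RtoC (binom (S i) (S i)) * f (S i)).
  rewrite !binom_diag.
  rewrite (cs_ext (fun r => RtoC (binom (S i) (S r)) * f (S r))
             (fun r => RtoC (binom i r) * f (S r) + RtoC (binom i (S r)) * f (S r))).
  - rewrite cs_plus; ring.
  - intros k Hk; unfold binom; rewrite <- (pascal i k Hk), RtoC_plus; ring.
Qed.

Lemma RtoC_sign_S (n : nat) : RtoC ((-1) ^ S n) = - RtoC ((-1) ^ n).
Proof. rewrite <- RtoC_opp; f_equal; simpl; ring. Qed.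

(** The left side is the k-th difference of (b)_n / (c)_n at n = 0, that is 2F1(-k, b; c; 1). A
    single difference gives the same quotient minus b/c times the one with b and c both raised by 1,
    which leaves c - b unchanged. *)
Lemma chu_vandermonde (k : nat) (b c : C) :
  ~ nonpos_int c ->
  cs (fun n => RtoC (binom k n) * (RtoC ((-1) ^ n) * (poch b n / poch c n))) (S k)
  = poch (c - b) k / poch c k.
Proof.
  revert b c; induction k as [|k IH]; intros b c Hc.
  - simpl; rewrite binom_0; field; apply RtoC_neq0; lra.
  - rewrite cs_binom_S.
    assert (Hc0 : c <> 0) by (rewrite <- (Cplus_0_r c); apply (nonpos_int_shift c 0 Hc)).
    assert (Hc1 : ~ nonpos_int (c + 1)) by (apply (not_nonpos_int_add c 1 Hc)).
    rewrite (cs_ext _ (fun r => RtoC (binom k r) * (RtoC ((-1) ^ r) * (poch b r / poch c r))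
       - b / c * (RtoC (binom k r) * (RtoC ((-1) ^ r) * (poch (b + 1) r / poch (c + 1) r))))).
    + rewrite cs_minus, cs_scal, !IH by assumption.
      replace (c + 1 - (b + 1)) with (c - b) by ring.
      assert (E : poch c k * (c + nC k) = c * poch (c + 1) k)
        by (rewrite <- poch_first; reflexivity).
      rewrite !poch_S.
      assert (N1 := poch_neq0 c k Hc); assert (N2 := poch_neq0 (c + 1) k Hc1).
      assert (N3 := nonpos_int_shift c k Hc).
      replace (b / c * (poch (c - b) k / poch (c + 1) k))
        with (b * poch (c - b) k / (c * poch (c + 1) k)) by (field; auto).
      rewrite <- E; field; auto.
    + intros n Hn; rewrite !poch_first.
      rewrite RtoC_sign_S.
      field; repeat split; auto using poch_neq0.
Qed.

(** Coefficient of x^j in (1-x)^(-a) (1-x)^(-b) = (1-x)^(-a-b), obtained from a first-order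
    recurrence in j. *)
Lemma vandermonde (a b : C) (j : nat) :
  cs (fun n => poch a n / factC n * (poch b (j - n) / factC (j - n))) (S j)
  = poch (a + b) j / factC j.
Proof.
  set (p := fun x n => poch x n / factC n).
  assert (Hp : forall x n, nC (S n) * p x (S n) = (x + nC n) * p x n).
  { intros x n; unfold p; rewrite poch_S, factC_S, nC_S; field.
    split; [apply factC_neq0|apply nC_S_neq0]. }
  change (cs (fun n => p a n * p b (j - n)%nat) (S j) = p (a + b) j).
  induction j as [|j IH].
  { unfold p; simpl; rewrite factC_0; field; apply RtoC_neq0; lra. }
  assert (E : nC (S j) * cs (fun n => p a n * p b (S j - n)%nat) (S (S j))
              = (a + b + nC j) * cs (fun n => p a n * p b (j - n)%nat) (S j)).
  { rewrite <- cs_scal.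
    (* The weight j + 1 is split as n + (j + 1 - n). By [Hp] each half lowers one index, and the
       factors a + n and b + j - n add up to a + b + j. *)
    rewrite (cs_ext _ (fun n => nC n * p a n * p b (S j - n)%nat
                                + p a n * (nC (S j - n) * p b (S j - n)%nat))).
    2:{ intros n Hn; rewrite nC_sub by lia; ring. }
    rewrite cs_plus, (cs_first (fun n => nC n * p a n * _)).
    change (cs (fun n => p a n * (nC (S j - n) * p b (S j - n)%nat)) (S (S j)))
      with (cs (fun n => p a n * (nC (S j - n) * p b (S j - n)%nat)) (S j)
            + p a (S j) * (nC (S j - S j) * p b (S j - S j)%nat)).
    rewrite Nat.sub_diag, nC_0, <- cs_scal.
    replace (0 * p a 0%nat * p b (S j - 0)%nat) with (RtoC 0) by ring.
    replace (p a (S j) * (0 * p b 0%nat)) with (RtoC 0) by ring.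
    rewrite Cplus_0_l, Cplus_0_r, <- cs_plus; apply cs_ext; intros n Hn.
    rewrite Hp; replace (S j - S n)%nat with (j - n)%nat by lia.
    replace (S j - n)%nat with (S (j - n)) by lia; rewrite Hp, nC_sub by lia; ring. }
  rewrite IH, <- Hp in E.
  assert (N : nC (S j) <> 0) by (rewrite nC_S; apply nC_S_neq0).
  apply (f_equal (fun z => / nC (S j) * z)) in E.
  rewrite !Cmult_assoc, Cinv_l, !Cmult_1_l in E by exact N; exact E.
Qed.

(** * The reciprocal Gamma function *)

Lemma Cexp_plus (a b : C) : Cexp (a + b) = Cexp a * Cexp b.
Proof.
  destruct a as [x y], b as [x' y']; unfold Cexp, Cplus, Cmult, Re, Im; simpl.
  rewrite exp_plus, cos_plus, sin_plus; f_equal; ring.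
Qed.

Lemma Cexp_0 : Cexp 0 = 1.
Proof. unfold Cexp, RtoC; simpl; rewrite exp_0, cos_0, sin_0; f_equal; ring. Qed.

Lemma Cexp_neq0 (z : C) : Cexp z <> 0.
Proof.
  intros E; apply C1_nz; rewrite <- Cexp_0, <- (Cplus_opp_r z), Cexp_plus, E; ring.
Qed.

Lemma Cpow_pos_plus (a : R) (z w : C) :
  Cpow_pos a (z + w) = Cpow_pos a z * Cpow_pos a w.
Proof. unfold Cpow_pos; rewrite Cmult_plus_distr_r; apply Cexp_plus. Qed.

Lemma Cpow_pos_neq0 (a : R) (z : C) : Cpow_pos a z <> 0.
Proof. apply Cexp_neq0. Qed.

Lemma Cpow_pos_1 (a : R) : (0 < a)%R -> Cpow_pos a 1 = RtoC a.
Proof.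
  intros H; unfold Cpow_pos, Cexp; rewrite Cmult_1_l; simpl.
  rewrite exp_ln, cos_0, sin_0 by exact H; unfold RtoC; f_equal; ring.
Qed.

Lemma Cpow_pos_mult (a b : R) (z : C) :
  (0 < a)%R -> (0 < b)%R -> Cpow_pos (a * b) z = Cpow_pos a z * Cpow_pos b z.
Proof.
  intros Ha Hb; unfold Cpow_pos.
  rewrite ln_mult, RtoC_plus, Cmult_plus_distr_l by assumption; apply Cexp_plus.
Qed.

(** * Second-order estimates for the exponential and bounds for the logarithm *)

Lemma exp_second_order (x : R) : (Rabs x <= / 2)%R -> (0 <= exp x - 1 - x <= 2 * x ^ 2)%R.
Proof.
  intros H; apply Rabs_le_between in H.
  (* The inequality at x is the lower bound; at -x it gives exp x (1 - x) <= 1, hence the upper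
     one. *)
  assert (H1 := exp_ineq1_le x); assert (H2 := exp_ineq1_le (- x)).
  rewrite exp_Ropp in H2; assert (P := exp_pos x).
  split; [lra|].
  apply Rmult_le_compat_r with (r := exp x) in H2; [|lra].
  rewrite Rinv_l in H2 by lra; nra.
Qed.

Lemma sin_abs_le (y : R) : (Rabs (sin y) <= Rabs y)%R.
Proof.
  destruct (MVT_gen sin 0 y cos) as (c & _ & E).
  - intros; auto_derive; [exact I|ring].
  - intros; apply continuity_pt_filterlim, (ex_derive_continuous sin); auto_derive; exact I.
  - rewrite sin_0, !Rminus_0_r in E; rewrite E, Rabs_mult.
    assert (B := COS_bound c); assert (Rabs (cos c) <= 1)%R by (apply Rabs_le; lra).
    assert (P := Rabs_pos y); nra.
Qed.

Lemma cos_second_order (y : R) : (0 <= 1 - cos y <= y ^ 2 / 2)%R.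
Proof.
  split; [assert (B := COS_bound y); lra|].
  replace y with (2 * (y / 2))%R at 1 by field.
  rewrite cos_2a_sin.
  assert (H := sin_abs_le (y / 2)); apply Rsqr_le_abs_1 in H; unfold Rsqr in H; nra.
Qed.

Lemma sin_second_order (y : R) : (Rabs y <= / 2)%R -> (Rabs (sin y - y) <= y ^ 2)%R.
Proof.
  intros Hy.
  destruct (MVT_gen sin 0 y cos) as (c & Hc & E).
  - intros; auto_derive; [exact I|ring].
  - intros; apply continuity_pt_filterlim, (ex_derive_continuous sin); auto_derive; exact I.
  - rewrite sin_0, !Rminus_0_r in E; rewrite E.
    replace (cos c * y - y)%R with (- (1 - cos c) * y)%R by ring.
    rewrite Rabs_mult, Rabs_Ropp.
    destruct (cos_second_order c) as [C0 C1]; rewrite (Rabs_pos_eq (1 - cos c)) by lra.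
    assert (Hcy : (c ^ 2 <= y ^ 2)%R).
    { revert Hc; unfold Rmin, Rmax; destruct (Rle_dec 0 y); intros; nra. }
    rewrite <- (pow2_abs y) in *; assert (P := Rabs_pos y); nra.
Qed.

Lemma Cexp_second_order (w : C) :
  (Cmod w <= / 2)%R -> (Cmod (Cexp w - 1 - w) <= 6 * Cmod w ^ 2)%R.
Proof.
  intros Hw.
  assert (HR := Re_le_Cmod w); assert (HI := Im_le_Cmod w).
  set (m := Cmod w) in *; set (x := Re w) in *; set (y := Im w) in *.
  destruct (exp_second_order x ltac:(lra)) as [E0 E1].
  destruct (cos_second_order y) as [C0 C1].
  assert (S1 := sin_second_order y ltac:(lra)); assert (S0 := sin_abs_le y).
  assert (X2 : (x ^ 2 <= m ^ 2)%R) by (rewrite <- (pow2_abs x); apply pow_incr; split; [apply Rabs_pos|lra]).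
  assert (Y2 : (y ^ 2 <= m ^ 2)%R) by (rewrite <- (pow2_abs y); apply pow_incr; split; [apply Rabs_pos|lra]).
  eapply Rle_trans; [apply Cmod_le_Re_Im|].
  replace (Re (Cexp w - 1 - w)) with (exp x * cos y - 1 - x)%R
    by (unfold Cexp, x, y, Re, Im; simpl; ring).
  replace (Im (Cexp w - 1 - w)) with (exp x * sin y - y)%R
    by (unfold Cexp, x, y, Re, Im; simpl; ring).
  assert (Ax : (-/2 <= x <= /2)%R) by (apply Rabs_le_between; lra).
  (* 2.75 = 2 + (3/2)(1/2): the remainder of exp gives 2 x^2, and 1 + x <= 3/2 multiplies 1 - cos y
     <= y^2 / 2. The imaginary part contributes at most 3, and 6 rounds up the total. *)
  assert (A1 : (Rabs (exp x * cos y - 1 - x) <= 2.75 * m ^ 2)%R).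
  { replace (exp x * cos y - 1 - x)%R
      with ((exp x - 1 - x) * cos y + (1 + x) * - (1 - cos y))%R by ring.
    eapply Rle_trans; [apply Rabs_triang|]; rewrite !Rabs_mult, Rabs_Ropp.
    rewrite (Rabs_pos_eq (exp x - 1 - x)), (Rabs_pos_eq (1 + x)), (Rabs_pos_eq (1 - cos y)) by lra.
    assert (Rabs (cos y) <= 1)%R by (apply Rabs_le, COS_bound).
    assert (P := Rabs_pos (cos y)); nra. }
  assert (A4 : (Rabs (exp x * sin y - y) <= 2 * m ^ 2 + y ^ 2)%R).
  { replace (exp x * sin y - y)%R with ((exp x - 1) * sin y + (sin y - y))%R by ring.
    eapply Rle_trans; [apply Rabs_triang|]; rewrite Rabs_mult.
    apply Rplus_le_compat; [|exact S1].
    assert (Ex : (Rabs (exp x - 1) <= 2 * Rabs x)%R).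
    { replace (exp x - 1)%R with ((exp x - 1 - x) + x)%R by ring.
      eapply Rle_trans; [apply Rabs_triang|]; rewrite (Rabs_pos_eq (exp x - 1 - x)) by lra.
      rewrite <- (pow2_abs x) in E1; assert (P := Rabs_pos x); nra. }
    assert (P1 := Rabs_pos (exp x - 1)); assert (P2 := Rabs_pos (sin y)).
    assert (P3 := Rabs_pos x); assert (P4 := Rabs_pos y); nra. }
  lra.
Qed.

Lemma ln_le_sub1 (x : R) : (0 < x)%R -> (ln x <= x - 1)%R.
Proof. intros H; assert (E := exp_ineq1_le (ln x)); rewrite exp_ln in E by exact H; lra. Qed.

Lemma ln_succ_bounds (n : nat) :
  (1 <= n)%nat -> (/ INR (S n) <= ln (INR (S n)) - ln (INR n) <= / INR n)%R.
Proof.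
  intros Hn; apply le_INR in Hn; simpl (INR 1) in Hn.
  assert (HS : (INR (S n) = INR n + 1)%R) by apply S_INR.
  split.
  - assert (H := ln_le_sub1 (INR n / INR (S n)) ltac:(apply Rdiv_lt_0_compat; lra)).
    rewrite ln_div in H by lra.
    replace (INR n / INR (S n) - 1)%R with (- / INR (S n))%R in H by (rewrite HS; field; lra); lra.
  - rewrite <- ln_div by lra.
    eapply Rle_trans; [apply ln_le_sub1, Rdiv_lt_0_compat; lra|].
    right; rewrite HS; field; lra.
Qed.

(** * Infinite products and the Gauss limit *)

Lemma inv_INR_lim : is_lim_seq (fun n => / INR (S n))%R 0.
Proof.
  apply is_lim_seq_incr_1 with (u := fun n => (/ INR n)%R).
  replace (Finite 0) with (Rbar_inv p_infty) by reflexivity.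
  apply is_lim_seq_inv; [apply is_lim_seq_INR|discriminate].
Qed.

Lemma ex_series_inv_telescope : ex_series (fun n => / INR (S n) - / INR (S (S n)))%R.
Proof.
  exists 1%R; change (is_lim_seq (sum_n (fun n => / INR (S n) - / INR (S (S n)))%R) 1%R).
  apply (is_lim_seq_ext (fun n => 1 - / INR (S (S n)))%R).
  - intros n; induction n as [|n IH].
    + rewrite sum_O; simpl; field.
    + rewrite sum_Sn, <- IH.
      change (1 - / INR (S (S (S n))) = 1 - / INR (S (S n)) + (/ INR (S (S n)) - / INR (S (S (S n)))))%R.
      ring.
  - replace (Finite 1) with (Finite (1 - 0)) by (f_equal; ring).
    apply is_lim_seq_minus'; [apply is_lim_seq_const|].
    apply (is_lim_seq_incr_1 (fun n => / INR (S n))%R), inv_INR_lim.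
Qed.

(** The products are bounded by the exponential of a telescoping sum, so their increments are
    absolutely summable. The limit may be zero; non-vanishing has to come from the inverse
    product. *)
Lemma product_cv (p d : nat -> C) (A : R) (N : nat) :
  (forall n, (N <= n)%nat -> p (S n) = p n * (1 + d n)) ->
  (forall n, (N <= n)%nat -> (Cmod (d n) <= A * (/ INR n - / INR (S n)))%R) ->
  (1 <= N)%nat -> exists l, Clim p l.
Proof.
  intros Hp Hd HN.
  assert (Hpos : forall n, (N <= n)%nat -> (0 < / INR n - / INR (S n))%R).
  { intros n Hn; assert (0 < INR n)%R by (apply lt_0_INR; lia).
    rewrite S_INR; replace (/ INR n - / (INR n + 1))%R with (/ (INR n * (INR n + 1)))%R
      by (field; lra).
    apply Rinv_0_lt_compat; nra. }
  assert (HA : (0 <= A)%R).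
  { specialize (Hd N (Nat.le_refl N)); specialize (Hpos N (Nat.le_refl N)).
    assert (P := Cmod_ge_0 (d N)); nra. }
  assert (HB : forall k, (Cmod (p (k + N)%nat) <= Cmod (p N) * exp (A * (/ INR N - / INR (k + N))))%R).
  { induction k as [|k IH].
    - simpl; rewrite Rminus_diag, Rmult_0_r, exp_0; lra.
    - change (S k + N)%nat with (S (k + N)); rewrite Hp, Cmod_mult by lia.
      replace (A * (/ INR N - / INR (S (k + N))))%R
        with (A * (/ INR N - / INR (k + N)) + A * (/ INR (k + N) - / INR (S (k + N))))%R by ring.
      rewrite exp_plus, <- Rmult_assoc.
      apply Rmult_le_compat; [apply Cmod_ge_0|apply Cmod_ge_0|exact IH|].
      eapply Rle_trans; [apply Cmod_triangle|]; rewrite Cmod_1.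
      eapply Rle_trans; [|apply exp_ineq1_le].
      specialize (Hd (k + N)%nat ltac:(lia)); lra. }
  set (P := (Cmod (p N) * exp (A * / INR N))%R).
  assert (HP : forall k, (Cmod (p (k + N)%nat) <= P)%R).
  { intros k; eapply Rle_trans; [apply HB|].
    apply Rmult_le_compat_l; [apply Cmod_ge_0|].
    assert (0 < / INR (k + N))%R by (apply Rinv_0_lt_compat, lt_0_INR; lia).
    assert (L : (A * (/ INR N - / INR (k + N)) <= A * / INR N)%R)
      by (apply Rmult_le_compat_l; lra).
    destruct L as [L|L]; [left; now apply exp_increasing|rewrite L; lra]. }
  set (u := fun k => p (S (k + N)) - p (k + N)%nat).
  assert (Hu : forall k, (Cmod (u k) <= P * A * (/ INR (k + N) - / INR (S (k + N))))%R).
  { intros k; unfold u; rewrite Hp by lia.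
    replace (p (k + N)%nat * (1 + d (k + N)%nat) - p (k + N)%nat)
      with (p (k + N)%nat * d (k + N)%nat) by ring.
    rewrite Cmod_mult, Rmult_assoc; apply Rmult_le_compat; auto using Cmod_ge_0.
    apply Hd; lia. }
  assert (HE : ex_series (fun k => P * A * (/ INR (k + N) - / INR (S (k + N))))%R).
  { apply (ex_series_scal_l (P * A)%R (fun k => (/ INR (k + N) - / INR (S (k + N)))%R)).
    apply (ex_series_ext (fun k => (/ INR (S (N - 1 + k)) - / INR (S (S (N - 1 + k))))%R)).
    - intros k; replace (S (N - 1 + k)) with (k + N)%nat by lia; reflexivity.
    - apply (ex_series_incr_n (fun k => (/ INR (S k) - / INR (S (S k)))%R)).
      apply ex_series_inv_telescope. }
  assert (HER : ex_series (fun k => Re (u k))).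
  { eapply (@ex_series_le _ R_CompleteNormedModule); [|exact HE].
    intros k; eapply Rle_trans; [apply Re_le_Cmod|apply Hu]. }
  assert (HEI : ex_series (fun k => Im (u k))).
  { eapply (@ex_series_le _ R_CompleteNormedModule); [|exact HE].
    intros k; eapply Rle_trans; [apply Im_le_Cmod|apply Hu]. }
  exists (CSer u + p N); apply (Clim_shift _ _ (S N)).
  apply (Clim_ext (fun n => cs u (S n) + p N)).
  { intros n; replace (n + S N)%nat with (S n + N)%nat by lia.
    generalize (S n); intros m; unfold u.
    rewrite (cs_telescope (fun k => p (k + N)%nat)); simpl; ring. }
  apply Clim_plus; [|apply Clim_const].
  apply (Clim_ext (fun n => (sum_n (fun k => Re (u k)) n, sum_n (fun k => Im (u k)) n))).
  { intros n; rewrite cs_Re_Im; reflexivity. }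
  split; [exact (Series_correct _ HER)|exact (Series_correct _ HEI)].
Qed.

(** The inverse of [gauss_seq]: the Pochhammer symbol moves to the numerator, which is harmless at
    the poles of Gamma. *)
Definition rgauss (z : C) (n : nat) : C := poch z (S n) / (factC n * Cpow_pos (INR n) z).

Definition rgauss_step (z : C) (n : nat) : C :=
  (1 + z / nC (S n)) * Cexp (- z * RtoC (ln (INR (S n)) - ln (INR n))).

(** The step is (1 + z/(n+1)) (n/(n+1))^z. At n = 0 the identity persists whatever value [ln 0]
    takes, since it rests on the additivity of exponents alone. *)
Lemma rgauss_S (z : C) (n : nat) :
  rgauss z (S n) = rgauss z n * rgauss_step z n.
Proof.
  unfold rgauss, rgauss_step.
  assert (E : Cpow_pos (INR (S n)) z * Cexp (- z * RtoC (ln (INR (S n)) - ln (INR n)))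
              = Cpow_pos (INR n) z).
  { unfold Cpow_pos; rewrite <- Cexp_plus; f_equal; rewrite RtoC_minus; ring. }
  rewrite <- E, (poch_S z (S n)), factC_S, nC_S.
  field; repeat split; auto using factC_neq0, nC_S_neq0, Cpow_pos_neq0, Cexp_neq0.
Qed.

(** Since ln(n+1) - ln n lies between 1/(n+1) and 1/n, the first-order terms of the two factors
    nearly cancel and the rest is of second order. The bound 1/2 keeps the step away from zero for
    the inverse products. *)
Lemma rgauss_step_bound (z : C) :
  exists A N, (1 <= N)%nat /\ forall n, (N <= n)%nat ->
    (Cmod (rgauss_step z n - 1) <= A * (/ INR n - / INR (S n)))%R /\
    (Cmod (rgauss_step z n - 1) <= / 2)%R.
Proof.
  (* With s = 1/(n+1), t = 1/n and h the logarithmic increment: m comes from z (s - h), m^2 from z^2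
     s h, and 24 m^2 from the remainder 6 (m h)^2, using h^2 <= 2 (t - s) and |1 + z s| <= 2. *)
  set (m := Cmod z); set (A := (m + 25 * m ^ 2)%R).
  assert (Hm : (0 <= m)%R) by apply Cmod_ge_0.
  assert (HA : (0 <= A)%R) by (unfold A; nra).
  (* Beyond this threshold m/n and A/n are both at most 1/2. *)
  destruct (nfloor_ex (2 * m + 2 * A)) as [N HN]; [lra|].
  exists A, (S N); split; [lia|]; intros n Hn.
  assert (Hn1 : (INR N + 1 <= INR n)%R) by (rewrite <- S_INR; apply le_INR; lia).
  assert (HN0 := pos_INR N).
  destruct (ln_succ_bounds n ltac:(lia)) as [L1 L2].
  set (h := (ln (INR (S n)) - ln (INR n))%R) in *.
  set (s := (/ INR (S n))%R) in *; set (t := (/ INR n)%R) in *.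
  assert (Ht : (INR n * t = 1)%R) by (apply Rinv_r; lra).
  assert (Hs : ((INR n + 1) * s = 1)%R) by (unfold s; rewrite S_INR; apply Rinv_r; lra).
  assert (Ps : (0 < s)%R) by (apply Rinv_0_lt_compat, lt_0_INR; lia).
  assert (Pt : (0 < t)%R) by (apply Rinv_0_lt_compat; lra).
  assert (D : (t - s = s * t)%R) by nra.
  assert (T2 : (t <= 2 * s)%R) by nra.
  assert (Hmt : (m * t <= / 2)%R) by nra.
  assert (HAt : (A * t <= / 2)%R) by nra.
  assert (B : (Cmod (rgauss_step z n - 1) <= A * (t - s))%R).
  { set (E := Cexp (- z * RtoC h) - 1 - (- z * RtoC h)).
    assert (HE : (Cmod E <= 6 * (m * h) ^ 2)%R).
    { replace (m * h)%R with (Cmod (- z * RtoC h))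
        by (rewrite Cmod_mult, Cmod_opp, Cmod_R, Rabs_pos_eq by lra; reflexivity).
      apply Cexp_second_order; rewrite Cmod_mult, Cmod_opp, Cmod_R, Rabs_pos_eq by lra.
      fold m; nra. }
    (* Expansion of (1 + z s)(1 - z h + E) - 1. *)
    replace (rgauss_step z n - 1)
      with (z * RtoC (s - h) + (- (z * z) * RtoC (s * h) + (1 + z * RtoC s) * E)).
    2:{ unfold rgauss_step, E; fold h; unfold s, nC.
        rewrite RtoC_minus, RtoC_mult, RtoC_inv by (apply not_0_INR; lia).
        field; apply RtoC_neq0, not_0_INR; lia. }
    assert (H1 : (Cmod (z * RtoC (s - h)) <= m * (t - s))%R).
    { rewrite Cmod_mult, Cmod_R; apply Rmult_le_compat_l; [exact Hm|].
      rewrite Rabs_left1; lra. }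
    assert (H2 : (Cmod (- (z * z) * RtoC (s * h)) <= m ^ 2 * (t - s))%R).
    { rewrite Cmod_mult, Cmod_opp, Cmod_mult, Cmod_R, Rabs_pos_eq by nra; fold m.
      replace (m * m)%R with (m ^ 2)%R by ring; apply Rmult_le_compat_l; nra. }
    assert (H3 : (Cmod ((1 + z * RtoC s) * E) <= 24 * m ^ 2 * (t - s))%R).
    { rewrite Cmod_mult.
      assert (Q : (Cmod (1 + z * RtoC s) <= 2)%R).
      { eapply Rle_trans; [apply Cmod_triangle|].
        rewrite Cmod_1, Cmod_mult, Cmod_R, Rabs_pos_eq by lra; fold m; nra. }
      assert (H4 : (h ^ 2 <= 2 * (t - s))%R) by nra.
      assert (Q0 := Cmod_ge_0 (1 + z * RtoC s)); assert (E0 := Cmod_ge_0 E).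
      assert (H5 : (Cmod E <= 12 * m ^ 2 * (t - s))%R).
      { eapply Rle_trans; [exact HE|].
        replace (6 * (m * h) ^ 2)%R with (6 * m ^ 2 * h ^ 2)%R by ring.
        replace (12 * m ^ 2 * (t - s))%R with (6 * m ^ 2 * (2 * (t - s)))%R by ring.
        apply Rmult_le_compat_l; [nra|exact H4]. }
      nra. }
    eapply Rle_trans; [apply Cmod_triangle|].
    eapply Rle_trans; [apply Rplus_le_compat_l, Cmod_triangle|].
    unfold A; lra. }
  split; [exact B|]; eapply Rle_trans; [exact B|]; nra.
Qed.

Lemma rgauss_cv (z : C) : exists l, Clim (rgauss z) l.
Proof.
  destruct (rgauss_step_bound z) as (A & N & HN & H).
  apply (product_cv _ (fun n => rgauss_step z n - 1) A N); [|intros n Hn; now apply H|exact HN].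
  intros n _; rewrite rgauss_S; ring.
Qed.

Lemma rgauss_neq0 (z : C) (n : nat) : ~ nonpos_int z -> rgauss z n <> 0.
Proof.
  intros Hz E; apply (poch_neq0 z (S n) Hz).
  replace (poch z (S n)) with (rgauss z n * (factC n * Cpow_pos (INR n) z))
    by (unfold rgauss; field; auto using factC_neq0, Cpow_pos_neq0).
  rewrite E; ring.
Qed.

(** Convergence of the inverted products is what excludes a zero limit in [rG_neq0]. The constant
    doubles because the step has modulus at least 1/2. *)
Lemma inv_rgauss_cv (z : C) : ~ nonpos_int z -> exists l, Clim (fun n => / rgauss z n) l.
Proof.
  intros Hz; destruct (rgauss_step_bound z) as (A & N & HN & H).
  apply (product_cv _ (fun n => / rgauss_step z n - 1) (2 * A) N); [| |exact HN].
  - intros n Hn; rewrite rgauss_S.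
    assert (S0 : rgauss_step z n <> 0).
    { intros E; destruct (H n Hn) as [_ H2]; rewrite E in H2.
      replace (0 - 1) with (- (1)) in H2 by ring; rewrite Cmod_opp, Cmod_1 in H2; lra. }
    field; split; [exact S0|now apply rgauss_neq0].
  - intros n Hn; destruct (H n Hn) as [H1 H2].
    assert (L : (/ 2 <= Cmod (rgauss_step z n))%R).
    { assert (T := Cmod_triangle (rgauss_step z n) (- (rgauss_step z n - 1))).
      rewrite Cmod_opp in T.
      replace (rgauss_step z n + - (rgauss_step z n - 1)) with (RtoC 1) in T by ring.
      rewrite Cmod_1 in T; lra. }
    assert (S0 : rgauss_step z n <> 0) by (apply Cmod_gt_0; lra).
    replace (/ rgauss_step z n - 1) with (- (rgauss_step z n - 1) / rgauss_step z n)
      by (field; exact S0).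
    rewrite Cmod_div, Cmod_opp by exact S0.
    apply Rmult_le_reg_r with (Cmod (rgauss_step z n)); [lra|].
    unfold Rdiv; rewrite Rmult_assoc, Rinv_l by lra.
    assert (P := Cmod_ge_0 (rgauss_step z n - 1)); nra.
Qed.

(* The entire function 1/Gamma. *)
Definition rG (z : C) : C := epsilon (inhabits (RtoC 0)) (fun l => Clim (rgauss z) l).

Lemma rG_lim (z : C) : Clim (rgauss z) (rG z).
Proof. apply (epsilon_spec (inhabits (RtoC 0)) (fun l => Clim (rgauss z) l)), rgauss_cv. Qed.

Lemma rG_neq0 (z : C) : ~ nonpos_int z -> rG z <> 0.
Proof.
  intros Hz E; destruct (inv_rgauss_cv z Hz) as [l Hl].
  apply C1_nz; apply (Clim_unique (fun n => rgauss z n * / rgauss z n)).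
  - apply (Clim_ext (fun _ => 1)); [|apply Clim_const].
    intros n; rewrite Cinv_r; [reflexivity|now apply rgauss_neq0].
  - replace (RtoC 0) with (rG z * l) by (rewrite E; ring).
    apply Clim_mult; [apply rG_lim|exact Hl].
Qed.

(** The choice in [Gamma] returns a limit because one exists, and limits are unique. *)
Lemma Gamma_rG (z : C) : ~ nonpos_int z -> Gamma z = / rG z.
Proof.
  intros Hz.
  assert (L : Clim (gauss_seq z) (/ rG z)).
  { apply (Clim_ext (fun n => / rgauss z n)); [|apply Clim_inv; [now apply rG_neq0|apply rG_lim]].
    intros n; unfold rgauss, gauss_seq; fold (factC n).
    field; auto using factC_neq0, Cpow_pos_neq0, poch_neq0. }
  apply (Clim_unique (gauss_seq z)); [|exact L].
  apply Clim_filterlim, (epsilon_spec (inhabits (RtoC 0)) (fun g => is_Gamma z g)).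
  exists (/ rG z); now apply Clim_filterlim.
Qed.

Lemma Clim_RtoC (u : nat -> R) (l : R) :
  is_lim_seq u l -> Clim (fun n => RtoC (u n)) (RtoC l).
Proof. intros H; split; [exact H|apply is_lim_seq_const]. Qed.

Lemma rG_rec (z : C) : rG z = z * rG (z + 1).
Proof.
  apply (Clim_unique (fun n => z * rgauss (z + 1) (n + 1))).
  2:{ apply Clim_scal, (Clim_shift (rgauss (z + 1)) _ 1), rG_lim. }
  (* The two Gauss products differ by the factor 1 + (z+1)/(n+1), which tends to 1. *)
  apply (Clim_ext (fun n => rgauss z (n + 1) * (1 + (z + 1) * RtoC (/ INR (S n))))).
  - intros n; rewrite Nat.add_1_r; unfold rgauss.
    rewrite (poch_first z), Cpow_pos_plus, Cpow_pos_1 by (apply lt_0_INR; lia).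
    rewrite (poch_S (z + 1) (S n)), RtoC_inv by (apply not_0_INR; lia).
    fold (nC (S n)); field; repeat split; auto using factC_neq0, Cpow_pos_neq0.
    rewrite nC_S; apply nC_S_neq0.
  - replace (rG z) with (rG z * (1 + (z + 1) * 0)) by ring.
    apply Clim_mult; [apply (Clim_shift (rgauss z) _ 1), rG_lim|].
    apply Clim_plus; [apply Clim_const|]; apply Clim_scal, Clim_RtoC, inv_INR_lim.
Qed.

Lemma rG_shift (z : C) (n : nat) : rG z = poch z n * rG (z + nC n).
Proof.
  induction n as [|n IH]; [simpl; rewrite nC_0, Cplus_0_r; ring|].
  rewrite IH, poch_S, nC_S, (rG_rec (z + nC n)), Cplus_assoc; ring.
Qed.

(** Gauss's limit read as an asymptotic formula: Gamma(z + n + 1) behaves like n! n^z. It fixes the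
    constant in Bailey's theorem. *)
Lemma rG_asymptotic (z : C) :
  ~ nonpos_int z ->
  Clim (fun n => factC n * Cpow_pos (INR n) z * rG (z + nC n + 1)) 1.
Proof.
  intros Hz; apply (Clim_ext (fun n => rG z * / rgauss z n)).
  - intros n; rewrite (rG_shift z (S n)), nC_S, Cplus_assoc; unfold rgauss.
    field; auto using factC_neq0, Cpow_pos_neq0, poch_neq0.
  - replace (RtoC 1) with (rG z * / rG z) by (apply Cinv_r; now apply rG_neq0).
    apply Clim_scal, Clim_inv; [now apply rG_neq0|apply rG_lim].
Qed.

(** * The regularised hypergeometric series at 1/2 *)

Definition hcoef (a b : C) (k : nat) : C := poch a k * poch b k / factC k * RtoC ((/ 2) ^ k).

Definition hterm (a b c : C) (k : nat) : C := hcoef a b k * rG (c + nC k).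

(* 2F1(a, b; c; 1/2) / Gamma(c), which is entire in c. *)
Definition hreg (a b c : C) : C := CSer (hterm a b c).

Lemma RtoC2_neq0 : RtoC 2 <> 0.
Proof. apply RtoC_neq0; lra. Qed.

Lemma half_pow_S (k : nat) : RtoC ((/ 2) ^ S k) = RtoC ((/ 2) ^ k) / 2.
Proof.
  simpl; rewrite RtoC_mult, RtoC_inv by lra; field; apply RtoC2_neq0.
Qed.

Lemma hcoef_S (a b : C) (k : nat) :
  hcoef a b (S k) = (a + nC k) / (1 + nC k) * ((b + nC k) / 2) * hcoef a b k.
Proof.
  unfold hcoef; rewrite !poch_S, factC_S, half_pow_S.
  assert (H := nC_S_neq0 k); rewrite Cplus_comm in H.
  field; repeat split; auto using factC_neq0, RtoC2_neq0.
Qed.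

Lemma geo_of_bound (A r : R) (u : nat -> C) : (0 <= r < 1)%R -> geo_bound A r u -> geo u.
Proof. intros; exists A, r; auto. Qed.

(** The modulus of each term is eventually at most 18/25 of that of the preceding one, where 18/25 =
    (6/5)^2 / 2. Writing 1/Gamma(c+m) as (c+m)/Gamma(c+m+1) keeps c + m out of denominators, so the
    poles c are covered. *)
Lemma hterm_geo (a b c : C) : geo (hterm a b c).
Proof.
  destruct (shift_ratio a 1 (6/5) ltac:(lra)) as [M1 H1].
  destruct (shift_ratio b c (6/5) ltac:(lra)) as [M2 H2].
  destruct (geo_growth (hterm a b c) (18/25) (M1 + M2)) as (A & _ & HA);
    [lra| |apply (geo_of_bound A (18/25)); [lra|exact HA]].
  intros m Hm; destruct (H1 m ltac:(lia)) as [N1 L1]; destruct (H2 m ltac:(lia)) as [N2 L2].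
  unfold hterm; rewrite hcoef_S, (rG_rec (c + nC m)), nC_S.
  replace (c + (nC m + 1)) with (c + nC m + 1) by ring.
  set (g := rG (c + nC m + 1)); set (h := hcoef a b m).
  rewrite !Cmod_mult, !Cmod_div, Cmod_R, Rabs_pos_eq by (auto using RtoC2_neq0; lra).
  apply Cmod_gt_0 in N1.
  assert (P1 : (Cmod (a + nC m) / Cmod (1 + nC m) <= 6/5)%R).
  { apply Rmult_le_reg_r with (Cmod (1 + nC m)); [exact N1|].
    unfold Rdiv at 1; rewrite Rmult_assoc, Rinv_l by lra; lra. }
  assert (P0 : (0 <= Cmod (a + nC m) / Cmod (1 + nC m))%R).
  { apply Rmult_le_pos; [apply Cmod_ge_0|apply Rlt_le, Rinv_0_lt_compat, N1]. }
  set (q := (Cmod (a + nC m) / Cmod (1 + nC m))%R) in *.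
  assert (Pb := Cmod_ge_0 (b + nC m)); assert (Ph := Cmod_ge_0 h); assert (Pg := Cmod_ge_0 g).
  assert (Phg : (0 <= Cmod h * Cmod g)%R) by (apply Rmult_le_pos; lra).
  assert (Q : (q * (Cmod (b + nC m) / 2) <= 18 / 25 * Cmod (c + nC m))%R) by nra.
  apply Rmult_le_compat_r with (r := (Cmod h * Cmod g)%R) in Q; [|exact Phg].
  eapply Rle_trans; [|eapply Rle_trans; [exact Q|]]; right; ring.
Qed.

Lemma geo_mult_nC (u : nat -> C) : geo u -> geo (fun k => nC k * u k).
Proof.
  intros (B & r & Hr & Hu).
  (* rho > 1 absorbs the factor k, while rho r = 2r/(1+r) stays below 1. *)
  set (rho := (2 / (1 + r))%R).
  assert (E : (rho * (1 + r) = 2)%R) by (unfold rho; field; lra).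
  assert (Hrho : (1 < rho)%R) by nra.
  destruct (shift_ratio 1 0 rho Hrho) as [M HM].
  destruct (geo_growth nC rho M) as (A & HA & HB); [lra| |].
  { intros m Hm; destruct (HM m Hm) as [_ L].
    rewrite Cplus_0_l, Cplus_comm in L; rewrite nC_S; exact L. }
  apply (geo_of_bound (A * B) (rho * r)); [split; nra|].
  intros k; rewrite Cmod_mult, Rpow_mult_distr.
  replace (A * B * (rho ^ k * r ^ k))%R with ((A * rho ^ k) * (B * r ^ k))%R by ring.
  apply Rmult_le_compat; auto using Cmod_ge_0.
Qed.

Lemma hreg_bailey_rec (a c : C) :
  hreg a (1 - a) c = (c + a) * (c + 1 - a) * hreg a (1 - a) (c + 2).
Proof.
  unfold hreg; rewrite <- CSer_scal by apply hterm_geo.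
  (* The certificate is -2k times the k-th term at c + 1; it works because the numerator parameters
     a and 1 - a add up to 1. *)
  apply (CSer_telescope _ _ (fun k => - (2) * (nC k * hterm a (1 - a) (c + 1) k))).
  - apply hterm_geo.
  - apply geo_scal, hterm_geo.
  - rewrite nC_0; ring.
  - apply geo_lim_0, geo_scal, geo_mult_nC, hterm_geo.
  - intros k; unfold hterm; rewrite hcoef_S, nC_S.
    rewrite (rG_rec (c + nC k)), (rG_rec (c + nC k + 1)), (rG_rec (c + 1 + nC k)).
    replace (c + nC k + 1 + 1) with (c + 2 + nC k) by ring.
    replace (c + 1 + nC k + 1) with (c + 2 + nC k) by ring.
    replace (c + 1 + (nC k + 1)) with (c + 2 + nC k) by ring.
    assert (H := nC_S_neq0 k); rewrite Cplus_comm in H.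
    field; auto using RtoC2_neq0.
Qed.

(** Termwise: b (b+1)_k = (b)_k (b + k) and b + k = (c - 1 + k) - (c - b - 1), the first part being
    absorbed by 1/Gamma(c + k). It raises b at fixed a, which is the step i to i + 1 when b = 1 - a
    + i. *)
Lemma hreg_contiguous_b (a b c : C) :
  b * hreg a (b + 1) c = hreg a b (c - 1) - (c - b - 1) * hreg a b c.
Proof.
  enough (E : hreg a b (c - 1) = b * hreg a (b + 1) c + (c - b - 1) * hreg a b c)
    by (rewrite E; ring).
  unfold hreg; rewrite <- !CSer_scal, <- CSer_plus by auto using hterm_geo, geo_scal.
  apply CSer_ext; intros k; unfold hterm, hcoef.
  replace (b * (poch a k * poch (b + 1) k / factC k * RtoC ((/ 2) ^ k) * rG (c + nC k)))
    with (poch a k * (b * poch (b + 1) k) / factC k * RtoC ((/ 2) ^ k) * rG (c + nC k))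
    by (field; apply factC_neq0).
  rewrite <- poch_first, poch_S, (rG_rec (c - 1 + nC k)).
  replace (c - 1 + nC k + 1) with (c + nC k) by ring.
  field; apply factC_neq0.
Qed.

(** It raises a at fixed b, and 1 - a - (i+1) = 1 - (a+1) - i, so it lowers i when b = 1 - a - i. It
    holds only up to a telescoping term. *)
Lemma hreg_contiguous_a (a b c : C) :
  hreg a b c = / 2 * hreg (a + 1) b c + (c - b) / 2 * hreg (a + 1) b (c + 1).
Proof.
  unfold hreg; rewrite <- !CSer_scal, <- CSer_plus by auto using hterm_geo, geo_scal.
  apply (CSer_telescope _ _ (fun k =>
    match k with O => 0 | S j => (b + nC j) / 2 * hterm (a + 1) b (c + 1) j end)).
  - apply hterm_geo.
  - apply geo_plus; apply geo_scal, hterm_geo.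
  - reflexivity.
  - apply (Clim_shift _ _ 1).
    apply (Clim_ext (fun j => b / 2 * hterm (a + 1) b (c + 1) j
                              + / 2 * (nC j * hterm (a + 1) b (c + 1) j))).
    + intros n; rewrite Nat.add_1_r; field; apply RtoC2_neq0.
    + apply geo_lim_0, geo_plus; apply geo_scal; auto using geo_mult_nC, hterm_geo.
  - assert (H2 := RtoC2_neq0).
    intros [|j]; unfold hterm.
    + unfold hcoef; simpl poch; simpl pow; rewrite nC_0, factC_0, !Cplus_0_r, (rG_rec c).
      field; auto using C1_nz.
    + rewrite (hcoef_S (a + 1)); unfold hcoef.
      rewrite (poch_first a), !poch_S, factC_S, half_pow_S, nC_S.
      rewrite (rG_rec (c + (nC j + 1))).
      replace (c + (nC j + 1) + 1) with (c + 1 + (nC j + 1)) by ring.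
      replace (c + 1 + nC j) with (c + (nC j + 1)) by ring.
      rewrite (rG_rec (c + (nC j + 1))).
      replace (c + (nC j + 1) + 1) with (c + 1 + (nC j + 1)) by ring.
      assert (H := nC_S_neq0 j); assert (H' := H); rewrite Cplus_comm in H'.
      field; repeat split; auto using factC_neq0.
Qed.

(** Factor by factor, |x + j| >= Re x + j >= j + 1. The bound is uniform in x, as domination along c
    + 2N requires. *)
Lemma poch_inv_bound (x : C) (k : nat) :
  (1 <= Re x)%R -> x <> 0 /\ poch x k <> 0 /\ (Cmod (factC k / poch x k) <= 1)%R.
Proof.
  intros Hx.
  assert (Hn : ~ nonpos_int x) by (apply Re_pos_not_nonpos_int; lra).
  split; [rewrite <- (Cplus_0_r x); apply (nonpos_int_shift x 0 Hn)|].
  split; [now apply poch_neq0|].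
  induction k as [|k IH].
  - simpl; rewrite factC_0; replace (1 / 1) with (RtoC 1) by (field; apply C1_nz).
    rewrite Cmod_1; lra.
  - rewrite factC_S, poch_S.
    assert (N := nonpos_int_shift x k Hn).
    replace ((nC k + 1) * factC k / (poch x k * (x + nC k)))
      with ((nC k + 1) / (x + nC k) * (factC k / poch x k))
      by (field; auto using poch_neq0).
    rewrite Cmod_mult, Cmod_div, <- nC_S, Cmod_nC, S_INR by exact N.
    assert (L : (INR k + 1 <= Cmod (x + nC k))%R).
    { eapply Rle_trans; [|apply Re_le_Cmod]; eapply Rle_trans; [|apply Rle_abs].
      change (Re (x + nC k)) with (Re x + INR k)%R; lra. }
    assert (P := pos_INR k).
    assert (Q : ((INR k + 1) / Cmod (x + nC k) <= 1)%R).
    { apply Rmult_le_reg_r with (Cmod (x + nC k)); [lra|].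
      unfold Rdiv; rewrite Rmult_assoc, Rinv_l by lra; lra. }
    assert (Q0 : (0 <= (INR k + 1) / Cmod (x + nC k))%R).
    { apply Rmult_le_pos; [lra|]; apply Rlt_le, Rinv_0_lt_compat; lra. }
    assert (P1 := Cmod_ge_0 (factC k / poch x k)); nra.
Qed.

(** Each term with k > 0 is O(1/N), so Tannery's theorem leaves the zeroth term 1. *)
Lemma hyp_large_c (a b c : C) :
  (1 <= Re c)%R ->
  Clim (fun N => CSer (fun k => hcoef a b k / poch (c + nC (2 * N)) k)) 1.
Proof.
  intros Hc.
  assert (HcN : forall N, (1 + INR N <= Re (c + nC (2 * N)))%R).
  { intros N; change (Re (c + nC (2 * N))) with (Re c + INR (2 * N))%R; rewrite mult_INR; simpl (INR 2); assert (P := pos_INR N); lra. }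
  set (e := fun k => match k with O => RtoC 1 | S _ => RtoC 0 end).
  assert (Ee : CSer e = 1).
  { apply CSer_unique.
    - apply (geo_of_bound 1 0); [lra|]; intros [|k]; simpl; rewrite ?Cmod_1, ?Cmod_0; lra.
    - apply (Clim_shift _ _ 1), (Clim_ext (fun _ => 1)); [|apply Clim_const].
      intros n; rewrite Nat.add_1_r, cs_first; simpl.
      replace (cs (fun _ => 0) n) with (RtoC 0); [ring|].
      induction n as [|n IH]; simpl; [reflexivity|rewrite <- IH; ring]. }
  rewrite <- Ee.
  destruct (poch_fact_growth a (6/5) ltac:(lra)) as (A & HA & BA).
  destruct (poch_fact_growth b (6/5) ltac:(lra)) as (B & HB & BB).
  apply (CSer_dominated (A * B) (18/25) _ _ 0); [lra| |].
  - intros N _ k.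
    assert (HN := HcN N); assert (P := pos_INR N).
    destruct (poch_inv_bound (c + nC (2 * N)) k ltac:(lra)) as (_ & N1 & L).
    unfold hcoef.
    replace (poch a k * poch b k / factC k * RtoC ((/ 2) ^ k) / poch (c + nC (2 * N)) k)
      with ((poch a k / factC k) * (poch b k / factC k) * RtoC ((/ 2) ^ k)
            * (factC k / poch (c + nC (2 * N)) k))
      by (field; auto using factC_neq0).
    rewrite !Cmod_mult, Cmod_R, (Rabs_pos_eq ((/ 2) ^ k)) by (apply pow_le; lra).
    specialize (BA k); specialize (BB k); cbv beta in BA, BB.
    replace (A * B * (18 / 25) ^ k)%R
      with ((A * (6/5) ^ k) * (B * (6/5) ^ k) * (/ 2) ^ k * 1)%R.
    2:{ replace (18/25)%R with ((6/5) * (6/5) * / 2)%R by field.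
        rewrite !Rpow_mult_distr; ring. }
    assert (0 <= (/ 2) ^ k)%R by (apply pow_le; lra).
    repeat apply Rmult_le_compat; repeat apply Rmult_le_pos; auto using Cmod_ge_0; lra.
  - intros [|k].
    + apply (Clim_ext (fun _ => 1)); [|apply Clim_const].
      intros N; unfold hcoef; simpl; rewrite factC_0; field; apply C1_nz.
    + apply (Clim_0_le _ (fun N => Cmod (hcoef a b (S k)) * / INR (S N))%R).
      * intros N; assert (HN := HcN N); assert (P := pos_INR N).
        destruct (poch_inv_bound (c + nC (2 * N)) 0 ltac:(lra)) as (N0 & _).
        assert (HN1 : (1 <= Re (c + nC (2 * N) + 1))%R).
        { change (Re (c + nC (2 * N) + 1)) with (Re (c + nC (2 * N)) + 1)%R; lra. }
        destruct (poch_inv_bound (c + nC (2 * N) + 1) k HN1) as (_ & N1 & L).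
        rewrite poch_first.
        replace (hcoef a b (S k) / ((c + nC (2 * N)) * poch (c + nC (2 * N) + 1) k))
          with (hcoef a b (S k) * (/ (c + nC (2 * N)) * (/ factC k * (factC k / poch (c + nC (2 * N) + 1) k))))
          by (field; auto using factC_neq0).
        rewrite Cmod_mult; apply Rmult_le_compat_l; [apply Cmod_ge_0|].
        rewrite Cmod_mult, Cmod_inv by exact N0.
        rewrite <- (Rmult_1_r (/ INR (S N))); apply Rmult_le_compat.
        -- apply Rlt_le, Rinv_0_lt_compat, Cmod_gt_0, N0.
        -- apply Cmod_ge_0.
        -- apply Rinv_le_contravar; [apply lt_0_INR; lia|].
           rewrite S_INR; eapply Rle_trans; [|apply Re_le_Cmod].
           eapply Rle_trans; [|apply Rle_abs]; lra.
        -- rewrite Cmod_mult; apply Rle_trans with (1 * 1)%R; [|lra].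
           apply Rmult_le_compat; auto using Cmod_ge_0.
           unfold factC; rewrite <- RtoC_inv, Cmod_R by apply INR_fact_neq_0.
           assert (F : (1 <= INR (fact k))%R) by (apply (le_INR 1), lt_O_fact).
           rewrite Rabs_pos_eq; [|apply Rlt_le, Rinv_0_lt_compat; lra].
           rewrite <- Rinv_1; apply Rinv_le_contravar; lra.
      * replace (Finite 0) with (Rbar_mult (Cmod (hcoef a b (S k))) 0) by (simpl; f_equal; ring).
        apply is_lim_seq_scal_l, inv_INR_lim.
Qed.

Lemma hreg_eq_rG_mult (a b c : C) :
  ~ nonpos_int c -> hreg a b c = rG c * CSer (fun k => hcoef a b k / poch c k).
Proof.
  intros Hc.
  assert (E : forall k, hterm a b c k = rG c * (hcoef a b k / poch c k)).
  { intros k; unfold hterm; rewrite (rG_shift c k); field; auto using poch_neq0. }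
  rewrite <- CSer_scal; [now apply CSer_ext|].
  apply (geo_ext (fun k => / rG c * hterm a b c k)); [|apply geo_scal, hterm_geo].
  intros k; rewrite E; field; auto using poch_neq0, rG_neq0.
Qed.

(** * Bailey's theorem and its contiguous versions *)

(** Equality with [bailey_rhs] says 2F1(a, 1-a; c; 1/2) / Gamma(c) = 2^(a-1) Gamma((c+a-1)/2) /
    (Gamma(c+a-1) Gamma((c-a+1)/2)). The duplication formula relates this to the usual Gamma(c/2)
    Gamma((c+1)/2) / (Gamma((c+a)/2) Gamma((c-a+1)/2)); the present shape is the one met in the sums
    over r. *)
Definition bailey_lhs (a c : C) : C := rG ((c + a - 1) / 2) * hreg a (1 - a) c.

Definition bailey_rhs (a c : C) : C :=
  Cpow_pos 2 (a - 1) * rG (c + a - 1) * rG ((c - a + 1) / 2).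

Definition bailey_factor (a c : C) : C := (c + a - 1) / 2 * (c + a) * (c - a + 1).

Lemma bailey_lhs_rec (a c : C) : bailey_lhs a c = bailey_factor a c * bailey_lhs a (c + 2).
Proof.
  unfold bailey_lhs, bailey_factor; rewrite hreg_bailey_rec, (rG_rec ((c + a - 1) / 2)).
  replace ((c + a - 1) / 2 + 1) with ((c + 2 + a - 1) / 2) by (field; apply RtoC2_neq0).
  field; apply RtoC2_neq0.
Qed.

Lemma bailey_rhs_rec (a c : C) : bailey_rhs a c = bailey_factor a c * bailey_rhs a (c + 2).
Proof.
  unfold bailey_rhs, bailey_factor.
  rewrite (rG_rec (c + a - 1)), (rG_rec (c + a - 1 + 1)), (rG_rec ((c - a + 1) / 2)).
  replace ((c - a + 1) / 2 + 1) with ((c + 2 - a + 1) / 2) by (field; apply RtoC2_neq0).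
  replace (c + a - 1 + 1 + 1) with (c + 2 + a - 1) by ring.
  field; apply RtoC2_neq0.
Qed.

(** Cross-multiplied, because the common factor of the two recurrences may vanish and cannot be
    divided out. *)
Lemma bailey_cross (a c : C) (N : nat) :
  bailey_lhs a c * bailey_rhs a (c + nC (2 * N)) = bailey_rhs a c * bailey_lhs a (c + nC (2 * N)).
Proof.
  revert c; induction N as [|N IH]; intros c.
  - simpl (2 * 0)%nat; rewrite nC_0, Cplus_0_r; ring.
  - rewrite (bailey_lhs_rec a c), (bailey_rhs_rec a c).
    replace (c + nC (2 * S N)) with (c + 2 + nC (2 * N)).
    + rewrite <- !Cmult_assoc, IH; reflexivity.
    + replace (2 * S N)%nat with (S (S (2 * N))) by lia; rewrite !nC_S; ring.
Qed.

(** Scaled by W, both sides at c + 2N tend to 2^(a-1), which is nonzero, and [bailey_cross] carries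
    the equality back to c. The bound on Re c puts all arguments of [rG_asymptotic] in the right
    half-plane. *)
Lemma bailey_large (a c : C) :
  (3 + Rabs (Re a) < Re c)%R -> bailey_lhs a c = bailey_rhs a c.
Proof.
  intros Hc.
  assert (Ha := Rle_abs (Re a)); assert (Ha' := Rle_abs (- Re a)); rewrite Rabs_Ropp in Ha'.
  assert (P0 := Rabs_pos (Re a)).
  assert (H2 := RtoC2_neq0).
  assert (Rhalf : forall z : C, Re (z / 2) = (Re z / 2)%R).
  { intros z; unfold Cdiv; rewrite <- RtoC_inv by lra; destruct z; unfold Re; simpl; field. }
  assert (A1 := Clim_subseq _ _ (fun N => 2 * N)%nat ltac:(intros n; simpl; lia)
    (rG_asymptotic (c + a - 2) ltac:(apply Re_pos_not_nonpos_int;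
       change (Re (c + a - 2)) with (Re c + Re a - 2)%R; lra))).
  assert (A2 := Clim_subseq _ _ (fun N => 2 * N)%nat ltac:(intros n; simpl; lia)
    (rG_asymptotic (c - 1) ltac:(apply Re_pos_not_nonpos_int;
       change (Re (c - 1)) with (Re c - 1)%R; lra))).
  assert (A3 := rG_asymptotic ((c + a - 3) / 2) ltac:(apply Re_pos_not_nonpos_int; rewrite Rhalf;
       change (Re (c + a - 3)) with (Re c + Re a - 3)%R; lra)).
  assert (A4 := rG_asymptotic ((c - a - 1) / 2) ltac:(apply Re_pos_not_nonpos_int; rewrite Rhalf;
       change (Re (c - a - 1)) with (Re c - Re a - 1)%R; lra)).
  assert (A5 := hyp_large_c a (1 - a) c ltac:(lra)).
  cbv beta in A1, A2.
  (* W normalises the right side. The left side calls for the exponents c - 1 at 2N and (c + a -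
     3)/2 at N instead; the surplus (2N)^(a-1) against N^(a-1) is the origin of 2^(a-1). *)
  set (W := fun N => factC (2 * N) * Cpow_pos (INR (2 * N)) (c + a - 2)
                     * (factC N * Cpow_pos (INR N) ((c - a - 1) / 2))).
  assert (LY : Clim (fun N => bailey_rhs a (c + nC (2 * N)) * W N) (Cpow_pos 2 (a - 1))).
  { replace (Cpow_pos 2 (a - 1)) with (Cpow_pos 2 (a - 1) * (1 * 1)) by ring.
    eapply Clim_ext, (Clim_scal (Cpow_pos 2 (a - 1)) _ _ (Clim_mult _ _ _ _ A1 A4)).
    intros N; unfold bailey_rhs, W; cbv beta.
    replace (c + nC (2 * N) + a - 1) with (c + a - 2 + nC (2 * N) + 1) by ring.
    replace ((c + nC (2 * N) - a + 1) / 2) with ((c - a - 1) / 2 + nC N + 1).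
    - ring.
    - replace (2 * N)%nat with (N + N)%nat by lia; rewrite nC_add; field; exact H2. }
  assert (LX : Clim (fun N => bailey_lhs a (c + nC (2 * N)) * W N) (Cpow_pos 2 (a - 1))).
  { replace (Cpow_pos 2 (a - 1)) with (Cpow_pos 2 (a - 1) * (1 * 1 * 1)) by ring.
    eapply Clim_ext_loc, (Clim_scal (Cpow_pos 2 (a - 1)) _ _
      (Clim_mult _ _ _ _ (Clim_mult _ _ _ _ A2 A3) A5)).
    intros N HN; instantiate (1 := 1%nat) in HN.
    assert (PN : (0 < INR N)%R) by (apply lt_0_INR; lia).
    unfold bailey_lhs, W; cbv beta.
    rewrite (hreg_eq_rG_mult a (1 - a) (c + nC (2 * N))).
    2:{ apply not_nonpos_int_add, Re_pos_not_nonpos_int; lra. }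
    replace (c - 1 + nC (2 * N) + 1) with (c + nC (2 * N)) by ring.
    replace ((c + nC (2 * N) + a - 1) / 2) with ((c + a - 3) / 2 + nC N + 1)
      by (replace (2 * N)%nat with (N + N)%nat by lia; rewrite nC_add; field; exact H2).
    replace (c + a - 2) with (c - 1 + (a - 1)) by ring.
    replace ((c + a - 3) / 2) with ((c - a - 1) / 2 + (a - 1)) by (field; exact H2).
    rewrite !Cpow_pos_plus.
    replace (Cpow_pos (INR (2 * N)) (a - 1)) with (Cpow_pos 2 (a - 1) * Cpow_pos (INR N) (a - 1)).
    - ring.
    - rewrite <- Cpow_pos_mult by lra; f_equal; rewrite mult_INR; simpl; ring. }
  assert (E : Clim (fun N => bailey_lhs a c * (bailey_rhs a (c + nC (2 * N)) * W N))
                   (bailey_rhs a c * Cpow_pos 2 (a - 1))).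
  { eapply Clim_ext, (Clim_scal (bailey_rhs a c) _ _ LX).
    intros N; cbv beta; rewrite !Cmult_assoc, bailey_cross; reflexivity. }
  assert (E' := Clim_unique _ _ _ E (Clim_scal (bailey_lhs a c) _ _ LY)).
  apply (f_equal (fun z => z / Cpow_pos 2 (a - 1))) in E'.
  assert (N2 := Cpow_pos_neq0 2 (a - 1)).
  transitivity (bailey_lhs a c * Cpow_pos 2 (a - 1) / Cpow_pos 2 (a - 1)); [field; exact N2|].
  rewrite <- E'; field; exact N2.
Qed.

(* Bailey's theorem, free of exceptional values of c since both sides are divided by Gamma factors. *)
Lemma bailey (a c : C) : bailey_lhs a c = bailey_rhs a c.
Proof.
  destruct (nfloor_ex (Rmax 0 (3 + Rabs (Re a) - Re c))) as [N HN]; [apply Rmax_l|].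
  assert (H : (3 + Rabs (Re a) < Re (c + nC (2 * S N)))%R).
  { change (Re (c + nC (2 * S N))) with (Re c + INR (2 * S N))%R.
    rewrite mult_INR, (S_INR N); simpl (INR 2).
    assert (Rm := Rmax_r 0 (3 + Rabs (Re a) - Re c)); assert (P := pos_INR N); lra. }
  revert H; clear HN; generalize (S N); intros M; revert c; induction M as [|M IH]; intros c H.
  - apply bailey_large; simpl (2 * 0)%nat in H; rewrite nC_0, Cplus_0_r in H; exact H.
  - rewrite bailey_lhs_rec, bailey_rhs_rec, IH; [reflexivity|].
    replace (c + 2 + nC (2 * M)) with (c + nC (2 * S M)); [exact H|].
    replace (2 * S M)%nat with (S (S (2 * M))) by lia; rewrite !nC_S; ring.
Qed.

(** The contiguous relation involves c - 1 and c. Its factor c + a - i - 2 turns the prefactor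
    1/Gamma at c into the one at c - 1, so the two sums subtract and the signed Pascal rule merges
    them. The multipliers b accumulate to (1-a)_i. *)
Lemma hreg_plus_i (i : nat) (a c : C) :
  (forall r, (r <= i)%nat -> ~ nonpos_int ((c + a - nC i + nC r - 1) / 2)) ->
  poch (1 - a) i * hreg a (1 - a + nC i) c
  = Cpow_pos 2 (a - 1) * rG (c + a - nC i - 1)
    * cs (fun r => RtoC (binom i r) * (RtoC ((-1) ^ r)
             * (/ rG ((c + a - nC i + nC r - 1) / 2) * rG ((c - a - nC i + nC r + 1) / 2))))
         (S i).
Proof.
  revert c; induction i as [|i IH]; intros c Hc.
  - assert (B := bailey a c); unfold bailey_lhs, bailey_rhs in B.
    specialize (Hc O (Nat.le_refl _)); simpl cs; rewrite binom_0.
    rewrite nC_0 in *; simpl poch; simpl pow.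
    replace (c + a - 0 + 0 - 1) with (c + a - 1) in * by ring.
    replace (c - a - 0 + 0 + 1) with (c - a + 1) by ring.
    replace (c + a - 0 - 1) with (c + a - 1) by ring.
    replace (1 - a + 0) with (1 - a) by ring.
    assert (N := rG_neq0 _ Hc).
    transitivity (/ rG ((c + a - 1) / 2) * (rG ((c + a - 1) / 2) * hreg a (1 - a) c));
      [field; exact N|rewrite B; ring].
  - rewrite cs_binom_S, poch_S, nC_S.
    assert (E := hreg_contiguous_b a (1 - a + nC i) c).
    replace (1 - a + (nC i + 1)) with (1 - a + nC i + 1) by ring.
    transitivity (poch (1 - a) i * ((1 - a + nC i) * hreg a (1 - a + nC i + 1) c)); [ring|].
    rewrite E.
    transitivity (poch (1 - a) i * hreg a (1 - a + nC i) (c - 1)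
      - (c + a - nC i - 2) * (poch (1 - a) i * hreg a (1 - a + nC i) c)); [ring|].
    rewrite !IH.
    2:{ intros r Hr; specialize (Hc (S r) ltac:(lia)); rewrite !nC_S in Hc.
        replace (c + a - nC i + nC r - 1) with (c + a - (nC i + 1) + (nC r + 1) - 1) by ring.
        exact Hc. }
    2:{ intros r Hr; specialize (Hc r ltac:(lia)); rewrite !nC_S in Hc.
        replace (c - 1 + a - nC i + nC r - 1) with (c + a - (nC i + 1) + nC r - 1) by ring.
        exact Hc. }
    replace (c - 1 + a - nC i - 1) with (c + a - nC i - 2) by ring.
    replace (c + a - (nC i + 1) - 1) with (c + a - nC i - 2) by ring.
    rewrite (rG_rec (c + a - nC i - 2)).
    replace (c + a - nC i - 2 + 1) with (c + a - nC i - 1) by ring.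
    rewrite (cs_ext (fun r => RtoC (binom i r) * (RtoC ((-1) ^ r) * _ + _))
      (fun r => RtoC (binom i r) * (RtoC ((-1) ^ r)
             * (/ rG ((c - 1 + a - nC i + nC r - 1) / 2) * rG ((c - 1 - a - nC i + nC r + 1) / 2)))
       - RtoC (binom i r) * (RtoC ((-1) ^ r)
             * (/ rG ((c + a - nC i + nC r - 1) / 2) * rG ((c - a - nC i + nC r + 1) / 2))))).
    + rewrite cs_minus; ring.
    + intros r _; rewrite RtoC_sign_S, nC_S.
      replace (c + a - (nC i + 1) + nC r - 1) with (c - 1 + a - nC i + nC r - 1) by ring.
      replace (c - a - (nC i + 1) + nC r + 1) with (c - 1 - a - nC i + nC r + 1) by ring.
      replace (c + a - (nC i + 1) + (nC r + 1) - 1) with (c + a - nC i + nC r - 1) by ring.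
      replace (c - a - (nC i + 1) + (nC r + 1) + 1) with (c - a - nC i + nC r + 1) by ring.
      ring.
Qed.

(** Here a moves as well, so the induction runs over all a and c. The halves in the contiguous
    relation cancel against 2^a = 2 2^(a-1), and its factor c + a + i is absorbed by the recurrence
    of 1/Gamma. *)
Lemma hreg_minus_i (i : nat) (a c : C) :
  (forall r, (r <= i)%nat -> ~ nonpos_int ((c + a + nC i + nC r - 1) / 2)) ->
  hreg a (1 - a - nC i) c
  = Cpow_pos 2 (a - 1) * rG (c + a + nC i - 1)
    * cs (fun r => RtoC (binom i r)
             * (/ rG ((c + a + nC i + nC r - 1) / 2) * rG ((c - a - nC i + nC r + 1) / 2)))
         (S i).
Proof.
  revert a c; induction i as [|i IH]; intros a c Hc.
  - assert (B := hreg_plus_i 0 a c); rewrite !nC_0 in *.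
    replace (1 - a - 0) with (1 - a + 0) by ring.
    replace (c + a + 0 - 1) with (c + a - 0 - 1) by ring.
    simpl poch in B; rewrite Cmult_1_l in B; rewrite B.
    + simpl cs; rewrite nC_0; simpl pow.
      replace (c + a + 0 + 0 - 1) with (c + a - 0 + 0 - 1) by ring; ring.
    + intros r Hr; replace (c + a - 0 + nC r - 1) with (c + a + 0 + nC r - 1) by ring; auto.
  - rewrite cs_binom_S, nC_S, (hreg_contiguous_a a).
    replace (1 - a - (nC i + 1)) with (1 - (a + 1) - nC i) by ring.
    rewrite !IH.
    2:{ intros r Hr; specialize (Hc (S r) ltac:(lia)); rewrite !nC_S in Hc.
        replace (c + 1 + (a + 1) + nC i + nC r - 1) with (c + a + (nC i + 1) + (nC r + 1) - 1)
          by ring; exact Hc. }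
    2:{ intros r Hr; specialize (Hc r ltac:(lia)); rewrite !nC_S in Hc.
        replace (c + (a + 1) + nC i + nC r - 1) with (c + a + (nC i + 1) + nC r - 1) by ring.
        exact Hc. }
    replace (a + 1 - 1) with (a - 1 + 1) by ring.
    rewrite Cpow_pos_plus, Cpow_pos_1 by lra.
    replace (c + 1 + (a + 1) + nC i - 1) with (c + a + nC i + 1) by ring.
    replace (c + (a + 1) + nC i - 1) with (c + a + nC i) by ring.
    replace (c + a + (nC i + 1) - 1) with (c + a + nC i) by ring.
    rewrite (rG_rec (c + a + nC i)).
    rewrite (cs_ext (fun r => RtoC (binom i r) * (/ rG _ * _ + _))
      (fun r => RtoC (binom i r)
         * (/ rG ((c + (a + 1) + nC i + nC r - 1) / 2) * rG ((c - (a + 1) - nC i + nC r + 1) / 2))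
       + RtoC (binom i r)
         * (/ rG ((c + 1 + (a + 1) + nC i + nC r - 1) / 2)
            * rG ((c + 1 - (a + 1) - nC i + nC r + 1) / 2)))).
    + rewrite cs_plus; field; apply RtoC2_neq0.
    + intros r _; rewrite nC_S.
      replace (c + a + (nC i + 1) + nC r - 1) with (c + (a + 1) + nC i + nC r - 1) by ring.
      replace (c - a - (nC i + 1) + nC r + 1) with (c - (a + 1) - nC i + nC r + 1) by ring.
      replace (c + a + (nC i + 1) + (nC r + 1) - 1)
        with (c + 1 + (a + 1) + nC i + nC r - 1) by ring.
      replace (c - a - (nC i + 1) + (nC r + 1) + 1)
        with (c + 1 - (a + 1) - nC i + nC r + 1) by ring.
      ring.
Qed.

(** * The binomial series and Euler's transformation *)

(** The terms stay bounded at 3/4, since (6/5)(3/4) = 9/10, and 3/4 exceeds 1/2. *)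
Lemma CV_radius_half (A : R) (a : nat -> R) (x : R) :
  (forall k, (Rabs (a k) <= A * (6/5) ^ k)%R) -> (0 <= x <= / 2)%R ->
  Rbar_lt (Rabs x) (CV_radius a).
Proof.
  intros Ha Hx; apply Rbar_lt_le_trans with (3/4)%R.
  - simpl; rewrite Rabs_pos_eq; lra.
  - apply CV_radius_bounded; exists A; intros n; rewrite Rabs_mult.
    rewrite (Rabs_pos_eq ((3/4) ^ n)) by (apply pow_le; lra).
    assert (HA : (0 <= A)%R) by (specialize (Ha O); simpl in Ha; assert (P := Rabs_pos (a O)); lra).
    assert (H9 : ((9/10) ^ n <= 1)%R) by (rewrite <- (pow1 n); apply pow_incr; lra).
    apply Rle_trans with (A * (6/5) ^ n * (3/4) ^ n)%R.
    + apply Rmult_le_compat_r; [apply pow_le; lra|apply Ha].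
    + rewrite Rmult_assoc, <- Rpow_mult_distr.
      replace (6/5 * (3/4))%R with (9/10)%R by field; nra.
Qed.

Lemma PSeries_derive_1_minus_x (a : nat -> R) (x : R) :
  Rbar_lt (Rabs x) (CV_radius a) ->
  ((1 - x) * PSeries (PS_derive a) x = PSeries (fun n => INR (S n) * a (S n) - INR n * a n)%R x)%R.
Proof.
  intros Hx.
  assert (E : ex_pseries (PS_derive a) x)
    by (apply CV_radius_inside; rewrite CV_radius_derive; exact Hx).
  transitivity (PSeries (PS_minus (PS_derive a) (PS_incr_1 (PS_derive a))) x).
  - rewrite PSeries_minus, PSeries_incr_1; [ring|exact E|now apply ex_pseries_incr_1].
  - apply PSeries_ext; intros [|n]; unfold PS_minus, PS_plus, PS_opp, PS_derive, PS_incr_1.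
    + change (INR 1 * a 1%nat + - 0 = INR 1 * a 1%nat - INR 0 * a 0%nat)%R; simpl; ring.
    + reflexivity.
Qed.

(** The sum F of the series solves (1 - x) F' = g F with F(0) = 1, hence F = (1 - x)^(-g). Its real
    and imaginary parts u and v are treated as a coupled real system. *)
Lemma binomial_series_half (g : C) :
  CSer (fun k => poch g k / factC k * RtoC ((/ 2) ^ k)) = Cpow_pos 2 g.
Proof.
  destruct (poch_fact_growth g (6/5) ltac:(lra)) as (A & HA & HB).
  set (p := fun k => poch g k / factC k) in *.
  set (u := PSeries (fun k => Re (p k))); set (v := PSeries (fun k => Im (p k))).
  assert (Ru : forall x, (0 <= x <= / 2)%R -> Rbar_lt (Rabs x) (CV_radius (fun k => Re (p k)))).
  { intros x; apply (CV_radius_half A); intros k.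
    eapply Rle_trans; [apply Re_le_Cmod|apply HB]. }
  assert (Rv : forall x, (0 <= x <= / 2)%R -> Rbar_lt (Rabs x) (CV_radius (fun k => Im (p k)))).
  { intros x; apply (CV_radius_half A); intros k.
    eapply Rle_trans; [apply Im_le_Cmod|apply HB]. }
  set (gr := Re g); set (gi := Im g).
  assert (Hp : forall n, nC (S n) * p (S n) - nC n * p n = g * p n).
  { intros n; unfold p; rewrite poch_S, factC_S, nC_S; field.
    auto using factC_neq0, nC_S_neq0. }
  assert (Du : forall x, (0 <= x <= / 2)%R ->
    is_derive u x ((gr * u x - gi * v x) / (1 - x))%R).
  { intros x Hx; unfold u at 1.
    replace ((gr * u x - gi * v x) / (1 - x))%R with (PSeries (PS_derive (fun k => Re (p k))) x);
      [now apply is_derive_PSeries, Ru|].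
    apply Rmult_eq_reg_l with (1 - x)%R; [|lra].
    rewrite PSeries_derive_1_minus_x by auto.
    replace ((1 - x) * ((gr * u x - gi * v x) / (1 - x)))%R with (gr * u x - gi * v x)%R
      by (field; lra).
    unfold u, v; rewrite <- !PSeries_scal, <- PSeries_minus.
    - apply PSeries_ext; intros n; assert (E := f_equal Re (Hp n)).
      unfold PS_minus, PS_plus, PS_opp, PS_scal.
      change (INR (S n) * Re (p (S n)) - INR n * Re (p n)
              = gr * Re (p n) + - (gi * Im (p n)))%R.
      replace (gr * Re (p n) + - (gi * Im (p n)))%R with (Re (g * p n))
        by (unfold gr, gi, Re, Im; simpl; ring).
      rewrite <- E; unfold nC, Re; simpl; ring.
    - apply ex_pseries_scal; [apply Rmult_comm|apply CV_radius_inside; auto].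
    - apply ex_pseries_scal; [apply Rmult_comm|apply CV_radius_inside; auto]. }
  assert (Dv : forall x, (0 <= x <= / 2)%R ->
    is_derive v x ((gr * v x + gi * u x) / (1 - x))%R).
  { intros x Hx; unfold v at 1.
    replace ((gr * v x + gi * u x) / (1 - x))%R with (PSeries (PS_derive (fun k => Im (p k))) x);
      [now apply is_derive_PSeries, Rv|].
    apply Rmult_eq_reg_l with (1 - x)%R; [|lra].
    rewrite PSeries_derive_1_minus_x by auto.
    replace ((1 - x) * ((gr * v x + gi * u x) / (1 - x)))%R with (gr * v x + gi * u x)%R
      by (field; lra).
    unfold u, v; rewrite <- !PSeries_scal, <- PSeries_plus.
    - apply PSeries_ext; intros n; assert (E := f_equal Im (Hp n)).
      unfold PS_plus, PS_scal.
      change (INR (S n) * Im (p (S n)) - INR n * Im (p n)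
              = gr * Im (p n) + gi * Re (p n))%R.
      replace (gr * Im (p n) + gi * Re (p n))%R with (Im (g * p n))
        by (unfold gr, gi, Re, Im; simpl; ring).
      rewrite <- E; unfold nC, Im; simpl; ring.
    - apply ex_pseries_scal; [apply Rmult_comm|apply CV_radius_inside; auto].
    - apply ex_pseries_scal; [apply Rmult_comm|apply CV_radius_inside; auto]. }
  (* (1 - x)^g times the series has derivative zero. *)
  set (E := fun x => exp (gr * ln (1 - x))); set (th := fun x => (gi * ln (1 - x))%R).
  assert (D1 : (u 0 * (E 0 * cos (th 0)) - v 0 * (E 0 * sin (th 0))
              = u (/ 2) * (E (/ 2) * cos (th (/ 2))) - v (/ 2) * (E (/ 2) * sin (th (/ 2))))%R).
  { apply (eq_is_derive (fun x => u x * (E x * cos (th x)) - v x * (E x * sin (th x)))%R); [|lra].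
    intros x Hx; assert (U := Du x Hx); assert (V := Dv x Hx); unfold E, th.
    assert (XU : ex_derive u x) by (eexists; exact U).
    assert (XV : ex_derive v x) by (eexists; exact V).
    auto_derive; [repeat split; auto; lra|].
    change (fun x => u x) with u; change (fun x => v x) with v.
    rewrite (is_derive_unique _ _ _ U), (is_derive_unique _ _ _ V).
    unfold zero; simpl; field; lra. }
  assert (D2 : (u 0 * (E 0 * sin (th 0)) + v 0 * (E 0 * cos (th 0))
              = u (/ 2) * (E (/ 2) * sin (th (/ 2))) + v (/ 2) * (E (/ 2) * cos (th (/ 2))))%R).
  { apply (eq_is_derive (fun x => u x * (E x * sin (th x)) + v x * (E x * cos (th x)))%R); [|lra].
    intros x Hx; assert (U := Du x Hx); assert (V := Dv x Hx); unfold E, th.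
    assert (XU : ex_derive u x) by (eexists; exact U).
    assert (XV : ex_derive v x) by (eexists; exact V).
    auto_derive; [repeat split; auto; lra|].
    change (fun x => u x) with u; change (fun x => v x) with v.
    rewrite (is_derive_unique _ _ _ U), (is_derive_unique _ _ _ V).
    unfold zero; simpl; field; lra. }
  assert (U0 : u 0%R = 1%R).
  { unfold u; rewrite PSeries_0; unfold p; simpl poch; rewrite factC_0.
    replace (1 / 1) with (RtoC 1) by (field; apply C1_nz); reflexivity. }
  assert (V0 : v 0%R = 0%R).
  { unfold v; rewrite PSeries_0; unfold p; simpl poch; rewrite factC_0.
    replace (1 / 1) with (RtoC 1) by (field; apply C1_nz); reflexivity. }
  assert (L0 : (ln (1 - 0) = 0)%R) by (rewrite Rminus_0_r; apply ln_1).
  assert (L2 : (ln (1 - / 2) = - ln 2)%R).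
  { replace (1 - / 2)%R with (/ 2)%R by field; apply ln_Rinv; lra. }
  unfold E, th in D1, D2; rewrite U0, V0, L0, L2, !Rmult_0_r, exp_0, cos_0, sin_0 in D1, D2.
  assert (ES : CSer (fun k => p k * RtoC ((/ 2) ^ k)) = (u (/ 2), v (/ 2))%R).
  { unfold CSer, u, v, PSeries; f_equal; apply Series_ext; intros k; unfold Re, Im; simpl; ring. }
  change (CSer (fun k => p k * RtoC ((/ 2) ^ k)) = Cpow_pos 2 g); rewrite ES.
  (* The two conserved quantities are the real and imaginary parts of F(1/2) 2^(-g). *)
  assert (F : (u (/ 2), v (/ 2))%R * Cexp (- (g * RtoC (ln 2))) = 1).
  { unfold Cexp; replace (Re (- (g * RtoC (ln 2)))) with (gr * - ln 2)%R
      by (unfold gr, Re; simpl; ring).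
    replace (Im (- (g * RtoC (ln 2)))) with (gi * - ln 2)%R by (unfold gi, Im; simpl; ring).
    unfold Cmult, RtoC; simpl; f_equal; lra. }
  unfold Cpow_pos; rewrite <- (Cmult_1_l (Cexp (g * RtoC (ln 2)))), <- F.
  rewrite <- Cmult_assoc, <- Cexp_plus.
  replace (- (g * RtoC (ln 2)) + g * RtoC (ln 2)) with (RtoC 0) by ring.
  rewrite Cexp_0; symmetry; apply Cmult_1_r.
Qed.

Lemma binomial_term_geo (g : C) : geo (fun k => poch g k / factC k * RtoC ((/ 2) ^ k)).
Proof.
  destruct (poch_fact_growth g (6/5) ltac:(lra)) as (A & HA & HB).
  apply (geo_of_bound A (3/5)); [lra|]; intros k.
  rewrite Cmod_mult, Cmod_R, Rabs_pos_eq by (apply pow_le; lra).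
  replace (3/5)%R with ((6/5) * / 2)%R by field.
  rewrite Rpow_mult_distr, <- Rmult_assoc.
  apply Rmult_le_compat_r; [apply pow_le; lra|apply HB].
Qed.

(** * Regular summation and Euler's weights *)

Lemma Cmod_cs_le (f : nat -> C) (y : nat -> R) (n : nat) :
  (forall k, (k < n)%nat -> (Cmod (f k) <= y k)%R) ->
  (Cmod (cs f n) <= Re (cs (fun k => RtoC (y k)) n))%R.
Proof.
  induction n as [|n IH]; intros H; simpl cs; [rewrite Cmod_0; simpl; lra|].
  eapply Rle_trans; [apply Cmod_triangle|].
  change (Re (cs (fun k => RtoC (y k)) n + RtoC (y n)))
    with (Re (cs (fun k => RtoC (y k)) n) + y n)%R.
  apply Rplus_le_compat; auto with arith.
Qed.

(** Silverman-Toeplitz: finitely many columns tend to zero, and on the rest e is small against row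
    sums bounded by P. Row sums reuse the complex [cs], hence the [Re]. *)
Lemma toeplitz (w : nat -> nat -> C) (y : nat -> nat -> R) (P : R) (e : nat -> C) :
  (forall K n, (n <= K)%nat -> (Cmod (w K n) <= y K n)%R) ->
  (forall K, (Re (cs (fun n => RtoC (y K n)) (S K)) <= P)%R) ->
  (forall n, Clim (fun K => w K n) 0) -> Clim e 0 ->
  Clim (fun K => cs (fun n => w K n * e n) (S K)) 0.
Proof.
  intros Hw HP H0 He; apply Clim_eps; intros eps Heps.
  assert (HP0 : (0 <= P)%R).
  { eapply Rle_trans; [|apply (HP O)]; simpl; rewrite Rplus_0_l.
    eapply Rle_trans; [apply Cmod_ge_0|now apply (Hw O O)]. }
  set (eta := (eps / (2 * (P + 1)))%R).
  assert (Heta : (0 < eta)%R) by (apply Rdiv_lt_0_compat; lra).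
  assert (Heq : (eta * (P + 1) = eps / 2)%R) by (unfold eta; field; lra).
  rewrite Clim_eps in He; destruct (He eta Heta) as [M HM].
  assert (Hfin : Clim (fun K => cs (fun n => w K n * e n) M) 0).
  { replace (RtoC 0) with (cs (fun n => 0 * e n) M).
    - apply Clim_cs; intros n _; apply Clim_mult; [apply H0|apply Clim_const].
    - rewrite (cs_ext _ (fun n => 0 * 0)) by (intros; ring); rewrite cs_scal; ring. }
  rewrite Clim_eps in Hfin; destruct (Hfin (eps / 2)%R ltac:(lra)) as [K1 HK1].
  exists (M + K1)%nat; intros K HK; specialize (HK1 K ltac:(lia)).
  set (f1 := fun n => if Nat.ltb n M then w K n * e n else RtoC 0).
  set (f2 := fun n => if Nat.ltb n M then RtoC 0 else w K n * e n).
  assert (S1 : cs f1 (S K) = cs (fun n => w K n * e n) M).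
  { replace (S K) with (S K - M + M)%nat by lia; generalize (S K - M)%nat; intros d.
    induction d as [|d IH].
    - apply cs_ext; intros n Hn; unfold f1; apply Nat.ltb_lt in Hn; rewrite Hn; reflexivity.
    - change (S d + M)%nat with (S (d + M)); simpl cs; rewrite IH; unfold f1.
      replace (Nat.ltb (d + M) M) with false by (symmetry; apply Nat.ltb_ge; lia); ring. }
  assert (S2 : (Cmod (cs f2 (S K)) <= eta * P)%R).
  { apply Rle_trans with (Re (cs (fun n => RtoC (eta * y K n)) (S K))).
    - apply Cmod_cs_le; intros n Hn; unfold f2.
      assert (Hy := Hw K n ltac:(lia)); assert (Hc := Cmod_ge_0 (w K n)).
      destruct (Nat.ltb n M) eqn:En; [rewrite Cmod_0; nra|].
      apply Nat.ltb_ge in En; specialize (HM n En).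
      replace (e n - 0) with (e n) in HM by ring; rewrite Cmod_mult.
      assert (Pe := Cmod_ge_0 (e n)); nra.
    - rewrite (cs_ext _ (fun n => RtoC eta * RtoC (y K n))) by (intros; apply RtoC_mult).
      rewrite cs_scal; replace (Re (RtoC eta * cs (fun n => RtoC (y K n)) (S K)))
        with (eta * Re (cs (fun n => RtoC (y K n)) (S K)))%R by (unfold Re; simpl; ring).
      apply Rmult_le_compat_l; [lra|apply HP]. }
  rewrite (cs_ext _ (fun n => f1 n + f2 n)), cs_plus, S1.
  2:{ intros n _; unfold f1, f2; destruct (Nat.ltb n M); ring. }
  replace (cs (fun n => w K n * e n) M + cs f2 (S K) - 0)
    with ((cs (fun n => w K n * e n) M - 0) + cs f2 (S K)) by ring.
  eapply Rle_lt_trans; [apply Cmod_triangle|]; lra.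
Qed.

Lemma cs_abel (s G : nat -> C) (N : nat) :
  cs (fun n => (s (S n) - s n) * G n) N
  = s N * G N - s O * G O - cs (fun n => s (S n) * (G (S n) - G n)) N.
Proof. induction N as [|N IH]; simpl; [ring|rewrite IH; ring]. Qed.

(** Weight, for n <= K, of the partial sum of the terms 0, ..., n in the transformed partial sum up
    to K. *)
Definition euler_weight (g : C) (K n : nat) : C :=
  RtoC ((/ 2) ^ K) * (poch (g + nC n + 1) (K - n) / factC (K - n)).

(** For J = K + 1 - n this is the total weight of the n-th original term in the transformed sum up
    to K; its differences in n are the weights of the partial sums. *)
Definition euler_tau (g : C) (n J : nat) : C :=
  RtoC ((/ 2) ^ n) * cs (fun j => poch (g + nC n) j / factC j * RtoC ((/ 2) ^ j)) J.

Lemma euler_tau_diff_add (g : C) (n J : nat) :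
  euler_tau g n (S J) - euler_tau g (S n) J = euler_weight g (n + J) n.
Proof.
  assert (H2 := RtoC2_neq0).
  induction J as [|J IH].
  - unfold euler_tau, euler_weight; rewrite Nat.add_0_r, Nat.sub_diag; simpl cs; simpl poch.
    rewrite factC_0; simpl (RtoC ((/ 2) ^ 0)); field; apply C1_nz.
  - assert (T : forall m I, euler_tau g m (S I) = euler_tau g m I
              + RtoC ((/ 2) ^ m) * (poch (g + nC m) I / factC I * RtoC ((/ 2) ^ I)))
      by (intros; unfold euler_tau; simpl cs; ring).
    rewrite (T n (S J)), (T (S n) J).
    transitivity (euler_weight g (n + J) n
      + RtoC ((/ 2) ^ n) * (poch (g + nC n) (S J) / factC (S J) * RtoC ((/ 2) ^ S J))
      - RtoC ((/ 2) ^ S n) * (poch (g + nC (S n)) J / factC J * RtoC ((/ 2) ^ J)));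
      [rewrite <- IH; ring|].
    unfold euler_weight; replace (n + J - n)%nat with J by lia.
    replace (n + S J - n)%nat with (S J) by lia.
    rewrite Nat.add_succ_r, !half_pow_S, pow_add, RtoC_mult, nC_S.
    replace (g + (nC n + 1)) with (g + nC n + 1) by ring.
    rewrite (poch_first (g + nC n)), (poch_S (g + nC n + 1)), factC_S.
    field; auto using factC_neq0, nC_S_neq0.
Qed.

Lemma euler_tau_diff (g : C) (K n : nat) :
  (n <= K)%nat ->
  euler_tau g n (S K - n) - euler_tau g (S n) (S K - S n) = euler_weight g K n.
Proof.
  intros H; replace (S K - n)%nat with (S (K - n)) by lia.
  replace (S K - S n)%nat with (K - n)%nat by lia.
  rewrite euler_tau_diff_add; f_equal; lia.
Qed.

(** Telescoping in n leaves only the weight of the term n = 0, a partial sum of the binomial series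
    for 2^g. *)
Lemma euler_weight_sum (g : C) (K : nat) :
  cs (euler_weight g K) (S K) = cs (fun j => poch g j / factC j * RtoC ((/ 2) ^ j)) (S K).
Proof.
  rewrite (cs_ext _ (fun n => - (1) * (euler_tau g (S n) (S K - S n) - euler_tau g n (S K - n)))).
  - rewrite cs_scal, (cs_telescope (fun n => euler_tau g n (S K - n))).
    rewrite Nat.sub_diag, Nat.sub_0_r; unfold euler_tau; rewrite nC_0, Cplus_0_r.
    simpl (cs _ 0); simpl (RtoC ((/ 2) ^ 0)); ring.
  - intros n Hn; rewrite <- euler_tau_diff by lia; ring.
Qed.

Lemma poch_majorant (h : R) (j : nat) :
  (0 <= h)%R -> exists x : R, (0 <= x)%R /\ poch (RtoC h) j = RtoC x /\
    forall g, (Cmod g <= h)%R -> (Cmod (poch g j) <= x)%R.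
Proof.
  intros Hh; induction j as [|j (x & Hx & E & B)].
  - exists 1%R; split; [lra|]; split; [reflexivity|]; intros; simpl; rewrite Cmod_1; lra.
  - assert (P := pos_INR j).
    exists (x * (h + INR j))%R; split; [nra|]; split.
    + rewrite poch_S, E; unfold nC; rewrite RtoC_mult, RtoC_plus; reflexivity.
    + intros g Hg; rewrite poch_S, Cmod_mult; apply Rmult_le_compat; auto using Cmod_ge_0.
      eapply Rle_trans; [apply Cmod_triangle|]; rewrite Cmod_nC; lra.
Qed.

(** The weights of |g| dominate those of g, and [euler_weight_sum] evaluates their row sums; this
    yields the uniform bound that [toeplitz] asks for. *)
Lemma euler_weight_majorant (g : C) (K n : nat) :
  exists x : R, (Cmod (euler_weight g K n) <= x)%R /\
    euler_weight (RtoC (Cmod g)) K n = RtoC x.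
Proof.
  assert (Hg := Cmod_ge_0 g); assert (Pn := pos_INR n).
  destruct (poch_majorant (Cmod g + INR n + 1) (K - n) ltac:(lra)) as (x & Hx & E & B).
  exists ((/ 2) ^ K * (x / INR (fact (K - n))))%R; unfold euler_weight; split.
  - rewrite Cmod_mult, Cmod_R, Rabs_pos_eq by (apply pow_le; lra).
    apply Rmult_le_compat_l; [apply pow_le; lra|].
    rewrite Cmod_div by apply factC_neq0.
    assert (F : (0 < INR (fact (K - n)))%R) by apply INR_fact_lt_0.
    unfold factC; rewrite Cmod_R, Rabs_pos_eq by lra.
    apply Rmult_le_compat_r; [apply Rlt_le, Rinv_0_lt_compat, F|].
    apply B; eapply Rle_trans; [apply Cmod_triangle|]; rewrite Cmod_1.
    apply Rplus_le_compat_r; eapply Rle_trans; [apply Cmod_triangle|]; rewrite Cmod_nC; lra.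
  - rewrite RtoC_mult, RtoC_div, <- E, !RtoC_plus by apply INR_fact_neq_0; reflexivity.
Qed.

Lemma euler_weight_lim (g : C) (n : nat) : Clim (fun K => euler_weight g K n) 0.
Proof.
  apply (Clim_shift _ _ n).
  apply (Clim_ext (fun j => RtoC ((/ 2) ^ n)
           * (poch (g + nC n + 1) j / factC j * RtoC ((/ 2) ^ j)))).
  - intros j; unfold euler_weight; replace (j + n - n)%nat with j by lia.
    rewrite pow_add, RtoC_mult; field; apply factC_neq0.
  - replace (RtoC 0) with (RtoC ((/ 2) ^ n) * 0) by ring.
    apply Clim_scal, geo_lim_0, binomial_term_geo.
Qed.

(* Euler's series transformation with binomial weights of exponent -g; it is regular, so the
   series on the left need only converge conditionally. *)
Lemma euler_transform (g : C) (B : nat -> C) (L : C) :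
  Clim (cs (fun n => RtoC ((-1) ^ n) * (poch g n / factC n) * B n)) L ->
  Clim (cs (fun k => RtoC ((/ 2) ^ k) * (poch g k / factC k)
              * cs (fun n => RtoC (binom k n) * (RtoC ((-1) ^ n) * B n)) (S k)))
       (Cpow_pos 2 g * L).
Proof.
  set (c := fun n => RtoC ((-1) ^ n) * (poch g n / factC n) * B n); intros HL.
  apply (Clim_shift _ _ 1).
  (* The transformed partial sum splits into the weighted deviations from L, which tend to 0, and
     the row sum times L, which tends to 2^g L. *)
  apply (Clim_ext (fun K => cs (fun n => euler_weight g K n * (cs c (S n) - L)) (S K)
           + cs (fun j => poch g j / factC j * RtoC ((/ 2) ^ j)) (S K) * L)).
  - intros K; rewrite Nat.add_1_r.
    (* binom(k, n) (g)_k / k! = (g)_n / n! times (g+n)_(k-n) / (k-n)!, which isolates the original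
       term. *)
    rewrite (cs_ext (fun k => RtoC ((/ 2) ^ k) * _ * _)
      (fun k => cs (fun n => c n * (RtoC ((/ 2) ^ n) *
         (poch (g + nC n) (k - n) / factC (k - n) * RtoC ((/ 2) ^ (k - n))))) (S k))).
    2:{ intros k _; rewrite <- cs_scal; apply cs_ext; intros n Hn; unfold c, binom, Binomial.C.
        assert (N1 := INR_fact_neq_0 n); assert (N2 := INR_fact_neq_0 (k - n)).
        rewrite RtoC_div, RtoC_mult by (apply Rmult_integral_contrapositive; auto).
        change (RtoC (INR (fact k))) with (factC k); change (RtoC (INR (fact n))) with (factC n).
        change (RtoC (INR (fact (k - n)))) with (factC (k - n)).
        assert (Ek : poch g k = poch g n * poch (g + nC n) (k - n))
          by (rewrite <- poch_add; f_equal; lia).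
        assert (Ep : RtoC ((/ 2) ^ k) = RtoC ((/ 2) ^ n) * RtoC ((/ 2) ^ (k - n)))
          by (rewrite <- RtoC_mult, <- pow_add; do 2 f_equal; lia).
        rewrite Ek, Ep; field; auto using factC_neq0. }
    rewrite (cs_diag (fun n j => c n * (RtoC ((/ 2) ^ n) *
         (poch (g + nC n) j / factC j * RtoC ((/ 2) ^ j))))).
    rewrite (cs_ext (fun n => cs _ (S K - n))
      (fun n => (cs c (S n) - cs c n) * euler_tau g n (S K - n))).
    2:{ intros n _; unfold euler_tau; rewrite !cs_scal; simpl cs; ring. }
    (* Summation by parts passes from weights on the terms to weights on their partial sums. *)
    rewrite (cs_abel (cs c) (fun n => euler_tau g n (S K - n))).
    rewrite Nat.sub_diag, <- euler_weight_sum.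
    rewrite (cs_ext (fun n => cs c (S n) * _)
      (fun n => - (1) * (euler_weight g K n * cs c (S n)))).
    2:{ intros n Hn; rewrite <- euler_tau_diff by lia; ring. }
    rewrite (cs_ext (fun n => euler_weight g K n * (cs c (S n) - L))
      (fun n => euler_weight g K n * cs c (S n) - L * euler_weight g K n)) by (intros; ring).
    rewrite cs_minus, !cs_scal; unfold euler_tau at 1; simpl (cs _ 0); ring.
  - replace (Cpow_pos 2 g * L) with (0 + Cpow_pos 2 g * L) by ring.
    apply Clim_plus.
    + destruct (binomial_term_geo (RtoC (Cmod g))) as (A & r & Hr & HA).
      apply (toeplitz (euler_weight g) (fun K n => Re (euler_weight (RtoC (Cmod g)) K n))
               (A / (1 - r))).
      * intros K n _; destruct (euler_weight_majorant g K n) as (x & Hx & E).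
        rewrite E; exact Hx.
      * intros K; rewrite (cs_ext _ (euler_weight (RtoC (Cmod g)) K)).
        2:{ intros n _; destruct (euler_weight_majorant g K n) as (x & _ & E).
            rewrite E; reflexivity. }
        rewrite euler_weight_sum.
        eapply Rle_trans; [apply Rle_abs|]; eapply Rle_trans; [apply Re_le_Cmod|].
        assert (T := cs_tail A r _ 0 (S K) Hr HA).
        rewrite Nat.add_0_r in T; simpl (cs _ 0) in T; simpl (r ^ 0)%R in T.
        rewrite Rmult_1_r in T; unfold Cminus in T; rewrite Copp_0, Cplus_0_r in T; exact T.
      * apply euler_weight_lim.
      * replace (RtoC 0) with (L - L) by ring.
        apply Clim_minus; [|apply Clim_const].
        apply (Clim_ext (fun n => cs c (n + 1))).
        { intros n; rewrite Nat.add_1_r; reflexivity. }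
        now apply -> (Clim_shift (cs c)).
    + apply Clim_mult; [|apply Clim_const].
      rewrite <- binomial_series_half.
      apply (Clim_ext (fun n => cs (fun j => poch g j / factC j * RtoC ((/ 2) ^ j)) (n + 1))).
      { intros n; rewrite Nat.add_1_r; reflexivity. }
      apply -> (Clim_shift (cs (fun j => poch g j / factC j * RtoC ((/ 2) ^ j)))).
      apply CSer_lim, binomial_term_geo.
Qed.

(** * Reduction of the Appell series *)

Lemma hyp_term_geo (a b c : C) :
  ~ nonpos_int c ->
  geo (fun m => poch a m / factC m * (poch b m / poch c m) * RtoC ((/ 2) ^ m)).
Proof.
  intros Hc.
  destruct (poch_fact_growth a (6/5) ltac:(lra)) as (A & HA & BA).
  destruct (poch_ratio_growth b c (6/5) Hc ltac:(lra)) as (B & HB & BB).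
  apply (geo_of_bound (A * B) (18/25)); [lra|]; intros k.
  rewrite !Cmod_mult, Cmod_R, Rabs_pos_eq by (apply pow_le; lra).
  replace (18/25)%R with ((6/5) * (6/5) * / 2)%R by field; rewrite !Rpow_mult_distr.
  specialize (BA k); specialize (BB k); cbv beta in BA, BB.
  replace (A * B * ((6/5) ^ k * (6/5) ^ k * (/ 2) ^ k))%R
    with ((A * (6/5) ^ k) * (B * (6/5) ^ k) * (/ 2) ^ k)%R by ring.
  apply Rmult_le_compat_r; [apply pow_le; lra|].
  apply Rmult_le_compat; auto using Cmod_ge_0.
Qed.

Lemma pow_n_RtoC (x : R) (n : nat) : pow_n (RtoC x) n = RtoC (x ^ n).
Proof.
  induction n as [|n IH]; [reflexivity|].
  change (RtoC x * pow_n (RtoC x) n = RtoC (x * x ^ n)); rewrite IH, RtoC_mult; reflexivity.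
Qed.

(** For fixed N the estimate on rectangles survives M to infinity, which replaces each inner sum by
    its limit. The strict bound becomes weak there, hence e / 2. *)
Lemma pringsheim_iterated (a : nat -> nat -> C) (c : nat -> C) (L : C) :
  (forall n, Clim (cs (fun m => a m n)) (c n)) ->
  double_series_converges_to a L -> Clim (cs c) L.
Proof.
  intros Hc HL; apply (Clim_shift _ _ 1), Clim_eps; intros e He.
  destruct (HL (e / 2)%R ltac:(lra)) as [K HK]; exists K; intros N HN.
  rewrite Nat.add_1_r; apply Rle_lt_trans with (e / 2)%R; [|lra].
  apply (Clim_Cmod_le (fun M => dpartial a M N) _ _ _ K).
  - apply (Clim_ext (fun M => cs (fun n => cs (fun m => a m n) (M + 1)) (S N))).
    + intros M; unfold dpartial; rewrite Nat.add_1_r, sum_n_cs, <- cs_swap.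
      apply cs_ext; intros m _; rewrite sum_n_cs; reflexivity.
    + apply Clim_cs; intros n _; apply -> (Clim_shift (cs (fun m => a m n))); apply Hc.
  - intros M HM; left; now apply HK.
Qed.

Lemma F3_reduction (al be ep g L : C) :
  ~ nonpos_int be ->
  double_series_converges_to (F3_term al ep (be - ep) g be (RtoC (/ 2)) (RtoC (-1))) L ->
  hreg ep (al + g) be = rG be * (Cpow_pos 2 g * L).
Proof.
  intros Hbe HL.
  set (phi := fun n m => poch al m / factC m * (poch ep m / poch be (m + n)) * RtoC ((/ 2) ^ m)).
  assert (Gphi : forall n, geo (phi n)).
  { intros n.
    apply (geo_ext (fun m => / poch be n * (poch al m / factC m
             * (poch ep m / poch (be + nC n) m) * RtoC ((/ 2) ^ m)))).
    - intros m; unfold phi; rewrite (Nat.add_comm m n), poch_add.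
      field; auto using factC_neq0, poch_neq0, not_nonpos_int_add.
    - apply geo_scal, hyp_term_geo; now apply not_nonpos_int_add. }
  set (B := fun n => poch (be - ep) n * CSer (phi n)).
  assert (H1 : Clim (cs (fun n => RtoC ((-1) ^ n) * (poch g n / factC n) * B n)) L).
  { eapply pringsheim_iterated; [|exact HL]; intros n.
    unfold B; rewrite Cmult_assoc.
    apply (Clim_ext (fun M => RtoC ((-1) ^ n) * (poch g n / factC n) * poch (be - ep) n
                              * cs (phi n) M)).
    - intros M; rewrite <- cs_scal; apply cs_ext; intros m _; unfold F3_term, phi.
      rewrite !pow_n_RtoC; change (RtoC (INR (fact m))) with (factC m).
      change (RtoC (INR (fact n))) with (factC n).
      field; auto using factC_neq0, poch_neq0.
    - apply Clim_scal, CSer_lim, Gphi. }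
  apply euler_transform in H1.
  (* General term after Euler's transformation and Chu-Vandermonde: eps, beta and the powers of 1/2
     enter only through k + m. *)
  set (x := fun k m => poch g k / factC k * (poch al m / factC m)
              * (poch ep (k + m) / poch be (k + m)) * RtoC ((/ 2) ^ (k + m))).
  assert (Dx : forall k, RtoC ((/ 2) ^ k) * (poch g k / factC k)
              * cs (fun n => RtoC (binom k n) * (RtoC ((-1) ^ n) * B n)) (S k) = CSer (x k)).
  { intros k.
    (* The k-th difference is a finite sum, so it moves inside the series over m. *)
    set (f := fun n m => RtoC (binom k n) * (RtoC ((-1) ^ n) * poch (be - ep) n) * phi n m).
    destruct (CSer_cs f (S k)) as [Gf Ef]; [intros n _; apply geo_scal, Gphi|].
    rewrite (cs_ext _ (fun n => CSer (f n))).
    2:{ intros n _; unfold f; rewrite CSer_scal by apply Gphi; unfold B; ring. }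
    rewrite <- Ef, <- CSer_scal by exact Gf; apply CSer_ext; intros m.
    set (y := poch al m / factC m * (poch ep m / poch be m) * RtoC ((/ 2) ^ m)).
    rewrite (cs_ext _ (fun n => y * (RtoC (binom k n) * (RtoC ((-1) ^ n)
               * (poch (be - ep) n / poch (be + nC m) n))))).
    - assert (Hm : ~ nonpos_int (be + nC m)) by now apply not_nonpos_int_add.
      rewrite cs_scal, chu_vandermonde by exact Hm.
      replace (be + nC m - (be - ep)) with (ep + nC m) by ring.
      unfold x, y; rewrite (Nat.add_comm k m), !poch_add, pow_add, RtoC_mult.
      field; auto using factC_neq0, poch_neq0.
    - intros n _; unfold f, y, phi; rewrite poch_add.
      field; auto using factC_neq0, poch_neq0, not_nonpos_int_add. }
  destruct (poch_fact_growth g (6/5) ltac:(lra)) as (A1 & P1 & B1).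
  destruct (poch_fact_growth al (6/5) ltac:(lra)) as (A2 & P2 & B2).
  destruct (poch_ratio_growth ep be (6/5) Hbe ltac:(lra)) as (A3 & P3 & B3).
  assert (Bx : forall k m, (Cmod (x k m) <= A1 * A2 * A3 * (18/25) ^ (k + m))%R).
  { intros k m; unfold x; rewrite !Cmod_mult, Cmod_R, Rabs_pos_eq by (apply pow_le; lra).
    specialize (B1 k); specialize (B2 m); specialize (B3 (k + m)%nat).
    cbv beta in B1, B2, B3.
    replace (18/25)%R with ((6/5) * (6/5) * / 2)%R by field; rewrite !Rpow_mult_distr.
    replace (A1 * A2 * A3 * ((6/5) ^ (k + m) * (6/5) ^ (k + m) * (/ 2) ^ (k + m)))%R
      with ((A1 * (6/5) ^ k) * (A2 * (6/5) ^ m) * (A3 * (6/5) ^ (k + m)) * (/ 2) ^ (k + m))%R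
      by (rewrite !(pow_add (6/5)); ring).
    apply Rmult_le_compat_r; [apply pow_le; lra|].
    repeat apply Rmult_le_compat; repeat apply Rmult_le_pos; auto using Cmod_ge_0. }
  assert (Grow : geo (fun k => CSer (x k))).
  { apply (geo_of_bound (A1 * A2 * A3 / (1 - 18/25)) (18/25)); [lra|]; intros k.
    eapply Rle_trans; [apply (CSer_Cmod (A1 * A2 * A3 * (18/25) ^ k) (18/25)); [lra|]|].
    - intros m; rewrite Rmult_assoc, <- pow_add; apply Bx.
    - right; field. }
  assert (H2 : CSer (fun k => CSer (x k)) = Cpow_pos 2 g * L).
  { apply CSer_unique; [exact Grow|]; eapply Clim_ext, H1.
    intros K; apply cs_ext; intros k _; apply Dx. }
  assert (H3 := CSer_diag _ (18/25) x ltac:(lra) Bx); rewrite H2 in H3.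
  rewrite hreg_eq_rG_mult by exact Hbe; f_equal.
  apply CSer_unique.
  - apply (geo_ext (fun m => poch (al + g) m / factC m * (poch ep m / poch be m) * RtoC ((/ 2) ^ m)));
      [|now apply hyp_term_geo].
    intros m; unfold hcoef; field; auto using factC_neq0, poch_neq0.
  - eapply Clim_ext, H3; intros J; apply cs_ext; intros j _.
    (* Along a diagonal only the product of the two Pochhammer quotients varies, and Vandermonde's
       sum turns it into (alpha + gamma)_j / j!. *)
    rewrite (cs_ext _ (fun n => poch ep j / poch be j * RtoC ((/ 2) ^ j)
               * (poch g n / factC n * (poch al (j - n) / factC (j - n))))).
    + rewrite cs_scal, vandermonde, (Cplus_comm g al); unfold hcoef.
      field; auto using factC_neq0, poch_neq0.
    + intros n Hn; unfold x; replace (n + (j - n))%nat with j by lia; ring.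
Qed.

Theorem theorem8 (i : nat) (alpha beta eps : C) :
  (* first identity: gamma = 1 - alpha - eps + i *)
  ( ~ nonpos_int beta ->
    ~ nonpos_int (1 - eps) ->
    ~ nonpos_int (1 - eps + RtoC (INR i)) ->
    ~ nonpos_int (beta + eps - RtoC (INR i) - 1) ->
    (forall r : nat, (r <= i)%nat ->
       ~ nonpos_int ((beta + eps - RtoC (INR i) + RtoC (INR r) - 1) / 2) /\
       ~ nonpos_int ((beta - eps - RtoC (INR i) + RtoC (INR r) + 1) / 2)) ->
    forall L : C,
      double_series_converges_to
        (F3_term alpha eps (beta - eps) (1 - alpha - eps + RtoC (INR i)) beta
           (RtoC (/ 2)) (RtoC (-1))) L ->
      L = Cpow_pos 2 (alpha - RtoC (INR i) + 2 * eps - 2) * Gamma (1 - eps) * Gamma beta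
          / (Gamma (1 - eps + RtoC (INR i)) * Gamma (beta + eps - RtoC (INR i) - 1))
          * csum (fun r => RtoC ((-1) ^ r * binom i r)
                   * Gamma ((beta + eps - RtoC (INR i) + RtoC (INR r) - 1) / 2)
                   / Gamma ((beta - eps - RtoC (INR i) + RtoC (INR r) + 1) / 2)) i )
  /\
  (* second identity: gamma = 1 - alpha - eps - i *)
  ( ~ nonpos_int beta ->
    ~ nonpos_int (beta + eps + RtoC (INR i) - 1) ->
    (forall r : nat, (r <= i)%nat ->
       ~ nonpos_int ((beta + eps + RtoC (INR i) + RtoC (INR r) - 1) / 2) /\
       ~ nonpos_int ((beta - eps - RtoC (INR i) + RtoC (INR r) + 1) / 2)) ->
    forall L : C,
      double_series_converges_to
        (F3_term alpha eps (beta - eps) (1 - alpha - eps - RtoC (INR i)) beta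
           (RtoC (/ 2)) (RtoC (-1))) L ->
      L = Cpow_pos 2 (alpha + RtoC (INR i) + 2 * eps - 2) * Gamma beta
          / Gamma (beta + eps + RtoC (INR i) - 1)
          * csum (fun r => RtoC (binom i r)
                   * Gamma ((beta + eps + RtoC (INR i) + RtoC (INR r) - 1) / 2)
                   / Gamma ((beta - eps - RtoC (INR i) + RtoC (INR r) + 1) / 2)) i ).
Proof.
  split.
  - intros Hb He Hei Hbe Hr L HL.
    apply F3_reduction in HL; [|exact Hb].
    replace (alpha + (1 - alpha - eps + RtoC (INR i))) with (1 - eps + nC i) in HL
      by (unfold nC; ring).
    assert (F := hreg_plus_i i eps beta (fun r H => proj1 (Hr r H))); rewrite HL in F.
    unfold csum; rewrite sum_n_cs.
    rewrite (cs_ext _ (fun r => RtoC (binom i r) * (RtoC ((-1) ^ r)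
             * (/ rG ((beta + eps - nC i + nC r - 1) / 2) * rG ((beta - eps - nC i + nC r + 1) / 2))))).
    2:{ intros r Hri; destruct (Hr r ltac:(lia)) as [N1 N2].
        rewrite !Gamma_rG, RtoC_mult by assumption; unfold nC; field; auto using rG_neq0. }
    rewrite !Gamma_rG by assumption.
    set (S := cs _ _) in *; fold (nC i) in *.
    (* Gamma(1 - eps) / Gamma(1 - eps + i) is 1 / (1 - eps)_i, which accounts for the factor on the
       left of [hreg_plus_i]. *)
    assert (E1 := rG_shift (1 - eps) i).
    (* eps - 1 is the claimed exponent plus gamma, so the 2^gamma of the reduction cancels. *)
    assert (E2 : Cpow_pos 2 (eps - 1)
      = Cpow_pos 2 (alpha - nC i + 2 * eps - 2) * Cpow_pos 2 (1 - alpha - eps + nC i))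
      by (rewrite <- Cpow_pos_plus; f_equal; ring).
    assert (Hp := poch_neq0 _ i He).
    assert (N1 := rG_neq0 _ Hb); assert (N2 := rG_neq0 _ Hei); assert (N3 := rG_neq0 _ Hbe).
    assert (N4 := Cpow_pos_neq0 2 (1 - alpha - eps + nC i)).
    rewrite E1; rewrite E2 in F.
    transitivity (poch (1 - eps) i * (rG beta * (Cpow_pos 2 (1 - alpha - eps + nC i) * L))
      / (poch (1 - eps) i * rG beta * Cpow_pos 2 (1 - alpha - eps + nC i))).
    + field; auto.
    + rewrite F; field; auto.
  - intros Hb Hbe Hr L HL.
    apply F3_reduction in HL; [|exact Hb].
    replace (alpha + (1 - alpha - eps - RtoC (INR i))) with (1 - eps - nC i) in HL
      by (unfold nC; ring).
    rewrite (hreg_minus_i i eps beta (fun r H => proj1 (Hr r H))) in HL.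
    unfold csum; rewrite sum_n_cs.
    rewrite (cs_ext _ (fun r => RtoC (binom i r)
             * (/ rG ((beta + eps + nC i + nC r - 1) / 2) * rG ((beta - eps - nC i + nC r + 1) / 2)))).
    2:{ intros r Hri; destruct (Hr r ltac:(lia)) as [N1 N2].
        rewrite !Gamma_rG by assumption; unfold nC; field; auto using rG_neq0. }
    rewrite !Gamma_rG by assumption.
    set (S := cs _ _) in *; fold (nC i) in *.
    assert (E2 : Cpow_pos 2 (eps - 1)
      = Cpow_pos 2 (alpha + nC i + 2 * eps - 2) * Cpow_pos 2 (1 - alpha - eps - nC i))
      by (rewrite <- Cpow_pos_plus; f_equal; ring).
    assert (N1 := rG_neq0 _ Hb); assert (N3 := rG_neq0 _ Hbe).
    assert (N4 := Cpow_pos_neq0 2 (1 - alpha - eps - nC i)).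
    rewrite E2 in HL.
    transitivity ((rG beta * (Cpow_pos 2 (1 - alpha - eps - nC i) * L))
      / (rG beta * Cpow_pos 2 (1 - alpha - eps - nC i))).
    + field; auto.
    + rewrite <- HL; field; auto.
Qed.
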